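(* Let $p\in(1,2)\cup[3,5)$ and let $g\in L^\infty(\mathbb{R}^3)$ satisfy: $g\geqslant 0$; the set $\Omega_0=\{x\in\mathbb{R}^3:g(x)=0\}$ is bounded and has nonempty interior; and $\liminf_{|x|\to\infty}g(x)=1$. Let $\lambda\in(0,\lambda_\ast)$, where $\lambda_\ast\in(0,\infty)$ is as in (E1) of the context if $p\in(1,2)$ and $\lambda_\ast=+\infty$ if $p\in[3,5)$, and let $u_\mu$ be the solutions of the system $$-\Delta u+(1+\mu g(x))u+\lambda\phi u=|u|^{p-1}u,\qquad -\Delta\phi=u^2,\qquad \lim_{|x|\to\infty}\phi(x)=0\qquad (x\in\mathbb{R}^3)$$ provided by (E1) (if $p\in(1,2)$) or (E2) (if $p\in[3,5)$) of the context. Let $$\mu_0=3C_{p,\lambda}^{p-1}-3\ \text{ if }p\in(1,2),\qquad \mu_0=3M_0(\lambda)^{p-1}-3\ \text{ if }p\in[3,5).$$ If $\mu>\mu_0$ (with $\mu>0$), then there exist $A>0$ and $R_0>0$, independent of $\mu$, such that $$u_\mu(x)\leqslant A|x|^{-\frac12}e^{-\frac{\sqrt\mu}{2}(|x|-R_0)}\qquad\text{for }|x|>R_0\text{ and }\mu>\mu_0 .$$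
   Context: $\lambda,\mu$ are positive parameters and $V_\mu(x)=1+\mu g(x)$. $|\cdot|_q$ denotes the $L^q(\mathbb{R}^3)$ norm. $\mathscr{D}^{1,2}(\mathbb{R}^3)$ is the completion of $C_0^\infty(\mathbb{R}^3)$ in the norm $|\nabla u|_2$. $\mathscr{D}_V=\{u\in\mathscr{D}^{1,2}(\mathbb{R}^3):\int_{\mathbb{R}^3}V_\mu u^2dx<\infty\}$ is a Hilbert space with norm $\|u\|_{\mathscr{D}_V}^2=\int_{\mathbb{R}^3}|\nabla u|^2+V_\mu(x)u^2\,dx$ (equivalent to the $H^1(\mathbb{R}^3)$ norm). For $u\in\mathscr{D}_V$, $\phi_u$ is the unique solution in $\mathscr{D}^{1,2}(\mathbb{R}^3)$ of $-\Delta\phi=u^2$, and $$I(u)=\frac12\int_{\mathbb{R}^3}|\nabla u|^2+V_\mu(x)u^2\,dx+\frac{\lambda}{4}\int_{\mathbb{R}^3}\phi_u u^2\,dx-\frac1{p+1}\int_{\mathbb{R}^3}|u|^{p+1}dx .$$ $I\in C^1(\mathscr{D}_V,\mathbb{R})$ with $I'(u)\varphi=\int\nabla u\nabla\varphi+V_\mu u\varphi\,dx+\lambda\int\phi_u u\varphi\,dx-\int|u|^{p-1}u\varphi\,dx$. A (weak) solution of the system is $u\in\mathscr{D}_V$ (with $\phi=\phi_u$) such that $I'(u)\varphi=0$ for all $\varphi\in\mathscr{D}_V$; it is nontrivial if $u\not\equiv0$. Pointwise inequalities for $u_\mu$ are understood a.e. (E1) ($p\in(1,2)$.) With $C_{p,\lambda}=2^{\frac{2}{p-2}}(2-p)^{\frac{2p-1}{p-1}}[p(p-1)\lambda^{-1}]^{\frac{p}{2-p}}$: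 there is $\lambda_\ast\in(0,\infty)$ such that for every $\lambda\in(0,\lambda_\ast)$ and $\mu>C_{p,\lambda}^{p-1}-1$ the system has a nontrivial weak solution $(u,\phi)=(u,\phi_u)$ with $I(u)\in[\alpha,c_\lambda]$, $\|u\|_{\mathscr{D}_V}+|\nabla\phi|_2\leqslant M_\mu$, $|u|\leqslant C_{p,\lambda}$ and $0<\phi\leqslant C_\mu$ a.e., where $\alpha,c_\lambda>0$ are independent of $\mu$, the constants $M_\mu,C_\mu$ depend on $p,\lambda,\mu$, and $M_\mu$ is decreasing in $\mu$. (E2) ($p\in[3,5)$.) For every $\lambda>0$ there are positive constants $M_0(\lambda),M_1(\lambda),M(\lambda)$, independent of $\mu$ and nondecreasing in $\lambda$, $\alpha>0$ independent of $\lambda,\mu$, and $c_\lambda>0$ independent of $\mu$, such that for every $\mu>\max\{0,M_0(\lambda)^{p-1}-1\}$ the system has a nontrivial weak solution $(u,\phi)=(u,\phi_u)$ with $|u|\leqslant M_0(\lambda)$, $0<\phi\leqslant M_1(\lambda)$ a.e., $\|u\|_{\mathscr{D}_V}+|\nabla\phi|_2\leqslant M(\lambda)$ and $I(u)\in[\alpha,c_\lambda]$. ''The solutions provided by (E1)/(E2)'' means solutions with the listed properties, the constants being fixed. *)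

(* Defs.v *)
From HB Require Import structures.
From mathcomp Require Import all_boot all_order all_algebra.
From mathcomp Require Import all_classical all_reals all_analysis.

Set Implicit Arguments.
Unset Strict Implicit.
Unset Printing Implicit Defensive.

Import Order.TTheory GRing.Theory Num.Theory numFieldNormedType.Exports.

Local Open Scope classical_set_scope.
Local Open Scope ring_scope.

(* R^3 is R * R * R with its Borel sigma-algebra.  Elements of the spaces
   L^q, D^{1,2}, ... are represented by Borel functions, and identities and
   pointwise inequalities between them hold almost everywhere. *)

Section Lebesgue.
Context {R : realType}.

(* The library's Lebesgue measure is typed on measurableTypeR R; leb1 is the
   same function on the canonical measurable structure of R. *)
Definition leb1 : set R -> \bar R := @lebesgue_measure R.

HB.instance Definition _ := @isMeasure.Build _ R R leb1
  (measure0 (@lebesgue_measure R)) (@measure_ge0 _ _ _ (@lebesgue_measure R))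
  (@measure_semi_sigma_additive _ _ _ (@lebesgue_measure R)).

HB.instance Definition _ := @Measure_isSigmaFinite.Build _ R R leb1
  (@sigma_finiteT _ _ _ (@lebesgue_measure R)).

Definition leb2 : set (R * R) -> \bar R := (leb1 \x leb1)%E.

HB.instance Definition _ := Measure.on leb2.

Lemma leb2_sigma_finite : sigma_finite setT leb2.
Proof.
have /sigma_finiteP[F [TF ndF Foo]] := sigma_finiteT leb1.
exists (fun n => F n `*` F n).
  rewrite -setXTT TF predeqE => -[x y]; split.
    move=> [/= [n _ Fnx] [k _ Fky]]; exists (maxn n k) => //; split.
    - by move: x Fnx; exact/subsetPset/ndF/leq_maxl.
    - by move: y Fky; exact/subsetPset/ndF/leq_maxr.
  by move=> [n _ []/= ? ?]; split; exists n.
move=> k; have [mF Fk] := Foo k; split; first exact: measurableX.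
by rewrite /leb2 product_measure1E// lte_mul_pinfty// ge0_fin_numE.
Qed.

HB.instance Definition _ :=
  Measure_isSigmaFinite.Build _ _ _ leb2 leb2_sigma_finite.

Definition leb3 : set (R * R * R) -> \bar R := (leb2 \x leb1)%E.

HB.instance Definition _ := Measure.on leb3.

End Lebesgue.

Section Space.
Context {R : realType}.
Implicit Types (x : R * R * R) (u v f g : R * R * R -> R).
Implicit Types (G : 'I_3 -> R * R * R -> R).

(* Euclidean norm: the library norm on a product is the sup norm. *)
Definition enorm x : R := Num.sqrt (x.1.1 ^+ 2 + x.1.2 ^+ 2 + x.2 ^+ 2).

(* The filter |x| -> oo. *)
Definition at_infty : set_system (R * R * R) :=
  [set A | exists r : R, forall x, r < enorm x -> A x].

Definition admissible g :=
  [/\ measurable_fun setT g /\ finite_norm leb3 +oo%E g,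
      forall x, 0 <= g x,
      bounded_set [set x | g x = 0],
      interior [set x | g x = 0] !=set0
    & limf_einf (EFin \o g) at_infty = 1%E].

Definition basis3 (i : 'I_3) : R * R * R :=
  ((i == 0 :> nat)%:R, (i == 1 :> nat)%:R, (i == 2 :> nat)%:R).

Definition partial (i : 'I_3) f : R * R * R -> R := fun x => 'D_(basis3 i) f x.

Definition partials (s : seq 'I_3) f : R * R * R -> R := foldr partial f s.

Definition smooth f := forall s,
  continuous (partials s f : R * R * R -> R) /\
  forall i x, derivable (partials s f : R * R * R -> R) x (basis3 i).

(* C_0^oo(R^3). *)
Definition test_fun f :=
  smooth f /\ exists r : R, forall x, r < enorm x -> f x = 0.

Definition Lnorm3 (q : R) f : \bar R := 'N[leb3]_(q%:E)[EFin \o f]%E.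

(* D^{1,2} is the completion of C_0^oo in |grad u|_2.  By Sobolev's inequality
   |w|_6 <= S |grad w|_2 a sequence that is Cauchy in that norm also converges
   in L^6, which realizes the completion as a space of functions: u is in
   D^{1,2} with gradient G when test functions w_n exist with w_n -> u in L^6
   and grad w_n -> G in L^2.  G is unique up to a null set. *)
Definition D12_grad u G :=
  [/\ measurable_fun setT u, (forall i, measurable_fun setT (G i))
    & exists w : nat -> R * R * R -> R,
      [/\ forall n, test_fun (w n),
          (fun n => Lnorm3 6 (w n \- u)) @ \oo --> 0%E
        & forall i,
            (fun n => Lnorm3 2 (partial i (w n) \- G i)) @ \oo --> 0%E]].

Definition D12 u := exists G, D12_grad u G.

Definition grad u : 'I_3 -> R * R * R -> R :=
  xget (fun=> cst 0) [set G | D12_grad u G].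

Definition grad_dot u v x : R := \sum_(i < 3) grad u i x * grad v i x.

Definition grad_norm2 u : R :=
  fine (Lnorm3 2 (fun x => Num.sqrt (grad_dot u u x))).

Definition solves_poisson u phi := D12 phi /\ forall v, D12 v ->
  \int[leb3]_x grad_dot phi v x = \int[leb3]_x (u x ^+ 2 * v x).

(* phi_u; by the Riesz theorem it exists for u in D_V and is unique a.e. *)
Definition phi_ u : R * R * R -> R := xget (cst 0) [set f | solves_poisson u f].

Definition V (mu : R) g x : R := 1 + mu * g x.

Definition DV mu g u :=
  D12 u /\ (\int[leb3]_x (V mu g x * u x ^+ 2)%:E < +oo)%E.

Definition DV_norm mu g u : R :=
  Num.sqrt (\int[leb3]_x (grad_dot u u x + V mu g x * u x ^+ 2)).

Definition energy p lam mu g u : R :=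
  2^-1 * \int[leb3]_x (grad_dot u u x + V mu g x * u x ^+ 2)
  + lam / 4 * \int[leb3]_x (phi_ u x * u x ^+ 2)
  - (p + 1)^-1 * \int[leb3]_x (`|u x| `^ (p + 1)).

(* I'(u) v. *)
Definition energy_diff p lam mu g u v : R :=
  \int[leb3]_x (grad_dot u v x + V mu g x * u x * v x)
  + lam * \int[leb3]_x (phi_ u x * u x * v x)
  - \int[leb3]_x (`|u x| `^ (p - 1) * u x * v x).

Definition weak_sol p lam mu g u :=
  DV mu g u /\ forall v, DV mu g v -> energy_diff p lam mu g u v = 0.

(* Nontrivial weak solutions (u, phi_u) with alpha <= I(u) <= c, |u| <= K,
   0 < phi_u <= L and energy-norm bound M. *)
Definition bounded_sol g p lam mu (alpha c K L M : R) u :=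
  [/\ weak_sol p lam mu g u /\ ~ {ae leb3, forall x, u x = 0},
      alpha <= energy p lam mu g u <= c,
      DV_norm mu g u + grad_norm2 (phi_ u) <= M,
      {ae leb3, forall x, `|u x| <= K}
    & {ae leb3, forall x, 0 < phi_ u x <= L}].

Definition Cpl (p lam : R) : R :=
  2 `^ (2 / (p - 2)) * (2 - p) `^ ((2 * p - 1) / (p - 1))
  * (p * (p - 1) * lam^-1) `^ (p / (2 - p)).

Definition sub_range p lam mu := 0 < mu /\ Cpl p lam `^ (p - 1) - 1 < mu.

Definition sub_sol g p (alpha c : R -> R) (M C : R -> R -> R) lam mu u :=
  bounded_sol g p lam mu (alpha lam) (c lam) (Cpl p lam) (C lam mu) (M lam mu) u.

(* The constants are arguments, so that a family of solutions can be required
   to satisfy the bounds with the same constants. *)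
Definition sub_existence g p (lamstar : R) (alpha c : R -> R)
    (M C : R -> R -> R) :=
  0 < lamstar /\ forall lam, 0 < lam < lamstar ->
  [/\ 0 < alpha lam, 0 < c lam,
      forall mu1 mu2, sub_range p lam mu1 -> mu1 < mu2 ->
        M lam mu2 < M lam mu1
    & forall mu, sub_range p lam mu -> exists u, sub_sol g p alpha c M C lam mu u].

Definition super_range p (M0 : R -> R) lam mu :=
  Num.max 0 (M0 lam `^ (p - 1) - 1) < mu.

Definition super_sol g p (alpha : R) (c M0 M1 M : R -> R) lam mu u :=
  bounded_sol g p lam mu alpha (c lam) (M0 lam) (M1 lam) (M lam) u.

Definition pos_nondecreasing (f : R -> R) :=
  (forall l, 0 < l -> 0 < f l) /\ forall l1 l2, 0 < l1 -> l1 <= l2 -> f l1 <= f l2.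

Definition super_existence g p (alpha : R) (c M0 M1 M : R -> R) :=
  [/\ 0 < alpha, forall lam, 0 < lam -> 0 < c lam,
      [/\ pos_nondecreasing M0, pos_nondecreasing M1 & pos_nondecreasing M]
    & forall lam mu, 0 < lam -> super_range p M0 lam mu ->
        exists u, super_sol g p alpha c M0 M1 M lam mu u].

End Space.

(* Main.v *)
Require Import Defs.
From HB Require Import structures.
From mathcomp Require Import all_boot all_order all_algebra.
From mathcomp Require Import all_classical all_reals all_analysis.
From mathcomp Require Import measurable_realfun ring lra.

Set Implicit Arguments.
Unset Strict Implicit.
Unset Printing Implicit Defensive.

Import Order.TTheory GRing.Theory Num.Theory numFieldNormedType.Exports.

Local Open Scope classical_set_scope.
Local Open Scope ring_scope.

(** The reason for the decay is the maximum principle.  Put kappa = sqrt mu / 2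
    and rho = sqrt (1 + |x|^2).  The barrier
      W = C rho^(-1/2) exp (- kappa rho)
    satisfies - Delta W + kappa^2 W >= 0 on the whole space: the factor
    rho^(-1/2) contributes kappa / rho to Delta W / W, and the first order term of
    the Laplacian in dimension 3 contributes - 2 kappa / rho
    (laplacian_barrier_le).  Choose r with g >= 3/4 for
    |x| > r, and C with W >= K for |x| <= r, where K bounds |u|.  For |x| > r the
    potential of the equation for u is at least
      1 + mu g + lambda phi - K^(p-1) > 3 mu / 4 - mu / 3 > kappa^2,
    because mu > 3 K^(p-1) - 3 and phi > 0.  So u is a subsolution and W a
    supersolution of - Delta + kappa^2 where u > W, a set that avoids the ball of
    radius r, and therefore u <= W almost everywhere.  Since rho >= |x|, this is
    the announced bound; r depends on g alone, and C exp (- kappa sqrt (1 + r^2))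
    on r and K, so that the constants do not depend on mu.

    In the weak setting the comparison is made by testing the equation with
    v = h (u - W), where h (t) = exp (- 1 / t) for t > 0 and h (t) = 0 for
    t <= 0 (le_barrier).  A smooth h is preferable to the positive part: if test
    functions w_n approximate u, then h (w_n - W) are test functions that
    approximate v (excess_approx).  Their support is compact because W > 0, and
    they are smooth because the derivatives of h are combinations of the
    functions t^(-k) exp (- 1 / t).  This identifies the gradient of v as
    h' (u - W) (grad u - grad W), once gradients are known to be unique almost
    everywhere (D12_grad_unique).  Integrating the inequality for W by parts
    against h (w_n - W) and passing to the limit (barrier_supersolution), the two
    tested relations combine to
      0 >= int h' (u - W) |grad (u - W)|^2 + (q u - kappa^2 W) v,
    where q is the potential.  Both terms are nonnegative and the second one is
    positive where u > W. *)

(** * A flat cutoff *)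

Section flat.
Context {R : realType}.
Implicit Types (k : nat) (t : R).

(** The power of 1 / t is a parameter so that derivatives stay in the family. *)
Definition flat k t : R := if 0 < t then t^-1 ^+ k * expR (- t^-1) else 0.

Lemma flat_le0 k t : t <= 0 -> flat k t = 0.
Proof. by rewrite /flat ltNge => ->. Qed.

Lemma flat_ge0 k t : 0 <= flat k t.
Proof.
rewrite /flat; case: ifPn => // t0.
by rewrite mulr_ge0 ?expR_ge0// exprn_ge0// invr_ge0 ltW.
Qed.

Lemma flat_gt0 k t : 0 < t -> 0 < flat k t.
Proof. by move=> t0; rewrite /flat t0 mulr_gt0 ?expR_gt0// exprn_gt0// invr_gt0. Qed.

(** With s = 1 / t, this is s^k <= k! exp s. *)
Lemma flat_le_fact k t : flat k t <= k`!%:R.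
Proof.
rewrite /flat; case: ifPn => [t0|_]; last exact: ler0n.
rewrite expRN ler_pdivrMr ?expR_gt0//.
have s0 : 0 <= t^-1 by rewrite invr_ge0 ltW.
case: k => [|k].
  by rewrite expr0 fact0 mul1r -expR0 ler_expR.
rewrite mulrC -ler_pdivrMr ?ltr0n ?fact_gt0//.
by apply: le_trans (expR_ge1Dxn k s0); rewrite lerDr.
Qed.

Lemma flatS k t : flat k t = t * flat k.+1 t.
Proof.
rewrite /flat; case: ifPn => [t0|_]; last by rewrite mulr0.
by rewrite mulrA exprS mulrA divff ?gt_eqF// mul1r.
Qed.

Lemma is_derive_flat k t :
  is_derive t 1 (flat k) (flat k.+2 t - k%:R * flat k.+1 t).
Proof.
have [t0|t0|->] := ltgtP t 0.
- rewrite !flat_le0 ?ltW// mulr0 subr0.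
  apply: (near_eq_is_derive (f := cst 0)) => //.
  near=> s; rewrite flat_le0// ltW//; near: s; exact: lt_nbhsl.
- pose f (s : R) := s^-1 ^+ k * expR (- s^-1).
  apply: (near_eq_is_derive (f := f)).
    near=> s; rewrite /flat ifT//; near: s; exact: lt_nbhsr.
  have t1 : t != 0 by rewrite gt_eqF.
  have dV : is_derive t 1 (fun s : R => s^-1) (- t ^- 2).
    by apply: is_derive_eq; [exact: is_deriveV|rewrite /GRing.scale/= mulr1].
  have dE : is_derive t 1 (fun s : R => expR (- s^-1)) (t ^- 2 * expR (- t^-1)).
    apply: (is_derive_eq (is_derive1_comp _ _)).
    by rewrite opprK mulrC.
  have dP : is_derive t 1 (fun s : R => s^-1 ^+ k)
      ((k%:R * t^-1 ^+ k.-1) *: - t ^- 2).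
    by rewrite -exprfctE; exact: is_deriveX.
  apply: (is_derive_eq (is_deriveM dP dE)).
  rewrite /flat (_ : 0 < t = true)// /GRing.scale/=.
  case: k {f dP} => [|k]; first by rewrite !expr0; field.
  by rewrite /= -!exprVn !exprS; field.
- rewrite !flat_le0// mulr0 subr0.
  (* the difference quotient at 0 is flat k.+1 h = h * flat k.+2 h *)
  have q0 : (fun h : R => h^-1 *: (flat k (h *: 1 + 0) - flat k 0)) @ 0^' --> (0 : R).
    apply/cvgr0Pnorm_le => e e0.
    near=> h; have h0 : h != 0 by near: h; exact: nbhs_dnbhs_neq.
    rewrite [h *: 1]mulr1 addr0 [flat k 0]flat_le0// subr0 flatS.
    rewrite /GRing.scale/= mulKf// flatS normrM (ger0_norm (flat_ge0 _ _)).
    rewrite (@le_trans _ _ (`|h| * (k.+2)`!%:R))//.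
      by rewrite ler_wpM2l// flat_le_fact.
    rewrite -ler_pdivlMr ?ltr0n ?fact_gt0//; near: h.
    have d0 : 0 < e / (k.+2)`!%:R :> R by rewrite divr_gt0// ltr0n fact_gt0.
    apply: nbhs_dnbhs; exists (e / (k.+2)`!%:R) => //= h.
    by rewrite /= sub0r normrN => /ltW.
  apply: DeriveDef; first by apply/cvg_ex; exists 0.
  exact/cvg_lim.
Unshelve. all: by end_near. Qed.

Lemma continuous_flat k : continuous (flat k).
Proof.
move=> t; apply: differentiable_continuous; apply/derivable1_diffP.
by have := is_derive_flat k t => -[].
Qed.

Lemma flat_lipschitz k a b :
  `|flat k a - flat k b| <= ((k.+2)`!%:R + k%:R * (k.+1)`!%:R) * `|a - b|.
Proof.
wlog ab : a b / a <= b.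
  by move=> h; have [/h//|/ltW/h] := leP a b; rewrite distrC (distrC b).
have [c _] := MVT_segment ab (fun t _ => is_derive_flat k t)
  (continuous_subspaceT (@continuous_flat k)).
rewrite distrC (distrC a) => ->; rewrite normrM ler_wpM2r//.
rewrite (le_trans (ler_normB _ _))// lerD//.
  by rewrite ger0_norm ?flat_ge0// flat_le_fact.
rewrite normrM normr_nat ler_wpM2l//.
by rewrite ger0_norm ?flat_ge0// flat_le_fact.
Qed.

End flat.


(** * Smooth functions on the space *)

Section smooth_functions.
Context {R : realType}.
Local Notation E := (R * R * R)%type.
Implicit Types (x v : E) (f g : E -> R) (i j : 'I_3).

Definition coord i x : R :=
  match val i with 0 => x.1.1 | 1 => x.1.2 | _ => x.2 end.

(** A directional derivative is a one-variable derivative, which gives access to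
    the one-variable chain rule. *)
Lemma is_derive_line f x v (l : R) :
  is_derive x v f l <-> is_derive (0 : R) 1 (fun t => f (t *: v + x)) l.
Proof.
have e : 'D_v f x = 'D_1 (fun t : R => f (t *: v + x)) 0.
  rewrite /derive; set g1 := fun h => h^-1 *: _; set g2 := fun h => h^-1 *: _.
  suff -> : g1 = g2 by [].
  by rewrite funeqE /g1 /g2 => h /=; rewrite addr0 scale0r add0r [_%:A]mulr1.
split=> -[dl <-].
  by split; [exact: (derivable1P f x v).1|rewrite -e].
by split; [exact: (derivable1P f x v).2|rewrite e].
Qed.

Lemma is_derive_comp_dir (h : R -> R) f x v (a b : R) :
  is_derive x v f a -> is_derive (f x) 1 h b -> is_derive x v (h \o f) (b * a).
Proof.
move=> /is_derive_line df dh; apply/is_derive_line.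
have -> : (fun t : R => (h \o f) (t *: v + x)) = h \o (fun t => f (t *: v + x)).
  by [].
by apply: is_derive1_comp; rewrite scale0r add0r.
Qed.

Lemma coordD i x y : coord i (x + y) = coord i x + coord i y.
Proof. by rewrite /coord; case: (val i) => [|[|n]]. Qed.

Lemma coordZ i (a : R) x : coord i (a *: x) = a * coord i x.
Proof. by rewrite /coord; case: (val i) => [|[|n]]. Qed.

Lemma coord_basis i j : coord i (basis3 j) = (i == j)%:R :> R.
Proof.
case: i => -[|[|[|n]]] //= ?; case: j => -[|[|[|m]]] //= ?;
  by rewrite /coord /basis3 -val_eqE.
Qed.

Lemma continuous_coord i : continuous (coord i).
Proof.
have c1 : continuous (fst : E -> R * R) by move=> x; exact: cvg_fst.
have c2 : continuous (snd : E -> R) by move=> x; exact: cvg_snd.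
move=> x; rewrite /coord; case: (val i) => [|[|n]]; last exact: c2.
- by apply: (@continuous_comp _ _ _ fst fst); [exact: c1|exact: cvg_fst].
- by apply: (@continuous_comp _ _ _ fst snd); [exact: c1|exact: cvg_snd].
Qed.

Lemma is_derive_coord i j x :
  is_derive x (basis3 j) (coord i) ((i == j)%:R : R).
Proof.
apply/is_derive_line; rewrite -coord_basis.
have -> : (fun t : R => coord i (t *: basis3 j + x)) =
    (fun t => t * coord i (basis3 j)) \+ cst (coord i x).
  by apply/funext => t /=; rewrite coordD coordZ.
have e : 'D_1 (fun t : R => t * coord i (basis3 j)) 0 = coord i (basis3 j).
  by rewrite -derive1E derive1Mr// derive1_id mul1r.
have d : is_derive (0 : R) 1 (fun t : R => t * coord i (basis3 j)) (coord i (basis3 j)).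
  by apply: DeriveDef => //; exact: derivableM.
by apply: is_derive_eq; rewrite addr0.
Qed.

(** Adding 1 makes the distance rho = sqrt (1 + |x|^2) smooth at the origin. *)
Definition sqn x : R := 1 + \sum_(i < 3) coord i x ^+ 2.

Definition rinv x : R := (Num.sqrt (sqn x))^-1.

(** This is C rho^(-1/2) exp (- kap rho) with C = exp c. *)
Definition barrier (c kap : R) x : R :=
  expR (c - ln (sqn x) / 4 - kap * Num.sqrt (sqn x)).

Lemma sqn_ge1 x : 1 <= sqn x.
Proof. by rewrite lerDl sumr_ge0// => i _; exact: sqr_ge0. Qed.

Lemma sqn_gt0 x : 0 < sqn x.
Proof. exact: lt_le_trans (sqn_ge1 x). Qed.

Lemma continuous_sqn : continuous sqn.
Proof.
move=> x; apply: cvgD; first exact: cvg_cst.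
rewrite /= !big_ord_recl big_ord0.
under eq_fun do rewrite !big_ord_recl big_ord0.
by do !apply: cvgD; try exact: cvg_cst; apply: continuousM; exact: continuous_coord.
Qed.

Lemma is_derive_sqn i x : is_derive x (basis3 i) sqn (2 * coord i x).
Proof.
have -> : sqn = cst 1 + \sum_(j < 3) (coord j ^+ 2).
  apply/funext => y; rewrite /sqn /= -[RHS]/(1 + (\sum_(j < 3) (coord j ^+ 2)) y).
  by rewrite fct_sumE.
apply: is_derive_eq.
  apply: is_deriveD; apply: is_derive_sum => j; apply: is_deriveX.
  exact: is_derive_coord.
rewrite add0r (bigD1 i)//= eqxx expr1 big1 ?addr0.
  by rewrite /GRing.scale/= mulr1.
by move=> j /negbTE ->; rewrite scaler0.
Qed.

Lemma sqrt_sqn_gt0 x : 0 < Num.sqrt (sqn x).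
Proof. by rewrite sqrtr_gt0 sqn_gt0. Qed.

Lemma is_derive_rinv i x :
  is_derive x (basis3 i) rinv (- (coord i x * rinv x ^+ 3)).
Proof.
have s0 := sqrt_sqn_gt0 x.
have dV : is_derive (sqn x) 1 (fun s => (Num.sqrt s)^-1)
    (- (Num.sqrt (sqn x)) ^- 2 *: (2 * Num.sqrt (sqn x))^-1).
  by apply: is_deriveV; [rewrite gt_eqF|exact: is_derive1_sqrt (sqn_gt0 x)].
apply: (is_derive_eq (is_derive_comp_dir (is_derive_sqn i x) dV)).
rewrite /rinv /GRing.scale/=; field.
by rewrite gt_eqF.
Qed.

Lemma is_derive_barrier c kap i x : is_derive x (basis3 i) (barrier c kap)
  (- (coord i x * (rinv x ^+ 2 / 2 + kap * rinv x) * barrier c kap x)).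
Proof.
have s0 := sqrt_sqn_gt0 x; have q0 := sqn_gt0 x.
have dl : is_derive (sqn x) 1 (fun s => c - ln s / 4 - kap * Num.sqrt s)
    (- ((sqn x)^-1 / 4) - kap * (2 * Num.sqrt (sqn x))^-1).
  have d1 : is_derive (sqn x) 1 (@ln R) (sqn x)^-1 by exact: is_derive1_ln.
  have d2 : is_derive (sqn x) 1 (@Num.sqrt R) (2 * Num.sqrt (sqn x))^-1.
    exact: is_derive1_sqrt.
  have -> : (fun s => c - ln s / 4 - kap * Num.sqrt s) =
      cst c - 4^-1 *: (@ln R) - kap *: (@Num.sqrt R).
    by apply/funext => s; rewrite !fctE /GRing.scale/= [_ / 4]mulrC.
  apply: is_derive_eq.
  by rewrite sub0r /GRing.scale/= [4^-1 * _]mulrC mulN1r.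
apply: (is_derive_eq (is_derive_comp_dir (is_derive_sqn i x)
  (is_derive1_comp (is_derive_expR _) dl))).
rewrite -/(barrier c kap x) /rinv -[in (sqn x)^-1](sqr_sqrtr (ltW q0)).
by field; rewrite gt_eqF.
Qed.

Lemma is_derive_partial f i x : smooth f ->
  is_derive x (basis3 i) f (partial i f x).
Proof. by move=> sf; apply: derivableP; have [_] := sf [::]; exact. Qed.

Lemma smooth_continuous f : smooth f -> continuous f.
Proof. by move=> sf; have [] := sf [::]. Qed.

Lemma smooth_partial f i : smooth f -> smooth (partial i f).
Proof.
move=> sf s; have := sf (rcons s i).
by rewrite /partials foldr_rcons.
Qed.

Lemma partial_is_derive f i (df : E -> R) :
  (forall x, is_derive x (basis3 i) f (df x)) -> partial i f = df.
Proof. by move=> h; apply/funext => x; exact: derive_val. Qed.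

(** Smoothness quantifies over all iterated derivatives, so it is proved for a
    whole class of functions that is stable under partial derivatives. *)
Inductive smooth_gen : (E -> R) -> Prop :=
| gen_smooth f : smooth f -> smooth_gen f
| gen_cst a : smooth_gen (cst a)
| gen_coord i : smooth_gen (coord i)
| gen_rinv : smooth_gen rinv
| gen_barrier c kap : smooth_gen (barrier c kap)
| gen_add f g : smooth_gen f -> smooth_gen g -> smooth_gen (fun x => f x + g x)
| gen_mul f g : smooth_gen f -> smooth_gen g -> smooth_gen (fun x => f x * g x)
| gen_flat k f : smooth_gen f -> smooth_gen (fun x => flat k (f x)).

Lemma gen_opp f : smooth_gen f -> smooth_gen (fun x => - f x).
Proof.
move=> gf; have := gen_mul (gen_cst (-1)) gf.
by congr smooth_gen; apply/funext => x; rewrite mulN1r.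
Qed.

Lemma gen_exp f n : smooth_gen f -> smooth_gen (fun x => f x ^+ n).
Proof.
move=> gf; elim: n => [|n ih]; first exact: gen_cst.
by under eq_fun do rewrite exprS; exact: gen_mul.
Qed.

Lemma smooth_gen_derive f : smooth_gen f ->
  continuous f /\ forall i, smooth_gen (partial i f) /\
    forall x, is_derive x (basis3 i) f (partial i f x).
Proof.
have step g i (dg : E -> R) : smooth_gen dg ->
    (forall x, is_derive x (basis3 i) g (dg x)) ->
    smooth_gen (partial i g) /\
    forall x, is_derive x (basis3 i) g (partial i g x).
  by move=> gd d; rewrite (partial_is_derive d).
have crinv : continuous rinv.
  move=> x; apply: cvgV; first by rewrite gt_eqF// sqrt_sqn_gt0.
  by apply: (continuous_comp (@continuous_sqn x)); exact: sqrt_continuous.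
elim=> {f}.
- move=> f sf; split; first exact: smooth_continuous.
  move=> i; split; first exact/gen_smooth/smooth_partial.
  by move=> x; exact: is_derive_partial.
- move=> a; split; first exact: cst_continuous.
  by move=> i; apply: (step _ i (cst 0)) => //; exact: gen_cst.
- move=> i; split; first exact: continuous_coord.
  move=> j; apply: (step _ j (cst (i == j)%:R)) => [|x]; first exact: gen_cst.
  exact: is_derive_coord.
- split => // i; apply: (step _ i (fun x => - (coord i x * rinv x ^+ 3))).
    by apply: gen_opp; apply: gen_mul; [exact: gen_coord|apply: gen_exp; exact: gen_rinv].
  exact: is_derive_rinv.
- move=> c kap; split.
    suff ce : continuous (fun x => c - ln (sqn x) / 4 - kap * Num.sqrt (sqn x)).
      by move=> x; exact: (continuous_comp (ce x) (@continuous_expR R _)).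
    move=> x; apply: cvgB.
      apply: cvgB; first exact: cvg_cst.
      apply: cvgM; last exact: cvg_cst.
      apply: (continuous_comp (@continuous_sqn x)).
      exact/continuous_ln/sqn_gt0.
    apply: cvgM; first exact: cvg_cst.
    apply: (continuous_comp (@continuous_sqn x)).
    exact: sqrt_continuous.
  move=> i; apply: (step _ i _ _ (is_derive_barrier c kap i)).
  apply: gen_opp; apply: gen_mul; last exact: gen_barrier.
  apply: gen_mul; first exact: gen_coord.
  apply: gen_add; apply: gen_mul; try exact: gen_cst; last exact: gen_rinv.
  by apply: gen_exp; exact: gen_rinv.
- move=> f g gf [cf df] gg [cg dg]; split; first by move=> x; exact: cvgD (cf x) (cg x).
  move=> i; have [[gf' df'] [gg' dg']] := (df i, dg i).
  by apply: (step _ i _ (gen_add gf' gg')) => x; exact: is_deriveD.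
- move=> f g gf [cf df] gg [cg dg]; split; first by move=> x; exact: cvgM (cf x) (cg x).
  move=> i; have [[gf' df'] [gg' dg']] := (df i, dg i).
  by apply: (step _ i _ (gen_add (gen_mul gf gg') (gen_mul gg gf'))) => x; exact: is_deriveM.
- move=> k f gf [cf df]; split.
    by move=> x; apply: (continuous_comp (cf x)); exact: continuous_flat.
  move=> i; have [gf' df'] := df i.
  apply: (step _ i (fun x =>
    (flat k.+2 (f x) + - (k%:R * flat k.+1 (f x))) * partial i f x)).
    apply: gen_mul => //; apply: gen_add; first exact: gen_flat.
    by apply: gen_opp; apply: gen_mul; [exact: gen_cst|exact: gen_flat].
  by move=> x; exact: is_derive_comp_dir (df' x) (is_derive_flat k (f x)).
Qed.

Lemma smooth_genP f : smooth_gen f -> smooth f.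
Proof.
move=> gf s; have gs : smooth_gen (partials s f).
  elim: s => [//|i s ih] /=.
  by have [_ /(_ i)[]] := smooth_gen_derive ih.
have [? d] := smooth_gen_derive gs; split => // i x.
by have [_ /(_ x)[]] := d i.
Qed.

End smooth_functions.

(** * The barrier *)

Section barrier_theory.
Context {R : realType}.
Local Notation E := (R * R * R)%type.
Implicit Types (x v : E) (i j : 'I_3) (c kap : R).

Lemma smooth_barrier c kap : smooth (barrier c kap).
Proof. exact/smooth_genP/gen_barrier. Qed.

Lemma barrier_gt0 c kap x : 0 < barrier c kap x.
Proof. exact: expR_gt0. Qed.

Lemma rinv_gt0 x : 0 < rinv x.
Proof. by rewrite invr_gt0 sqrt_sqn_gt0. Qed.

Lemma rinv_sqn x : rinv x ^+ 2 * sqn x = 1.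
Proof.
rewrite /rinv exprVn sqr_sqrtr ?(ltW (sqn_gt0 x))// mulVf// gt_eqF//.
exact: sqn_gt0.
Qed.

Lemma rinv_le1 x : rinv x <= 1.
Proof.
rewrite invf_le1 ?sqrt_sqn_gt0// -sqrtr1 ler_wsqrtr//; exact: sqn_ge1.
Qed.

Lemma coord_rinv_le1 i x : `|coord i x| * rinv x <= 1.
Proof.
rewrite ler_pdivrMr ?sqrt_sqn_gt0// mul1r -sqrtr_sqr ler_wsqrtr//.
rewrite /sqn (bigD1 i)//= addrCA lerDl addr_ge0// sumr_ge0// => j _.
exact: sqr_ge0.
Qed.

Lemma partial_barrier c kap i : partial i (barrier c kap) =
  fun x => - (coord i x * (rinv x ^+ 2 / 2 + kap * rinv x) * barrier c kap x).
Proof. exact/partial_is_derive/is_derive_barrier. Qed.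

Lemma partial_barrier_le c kap i x : 0 <= kap ->
  `|partial i (barrier c kap) x| <= (1 + kap) * barrier c kap x.
Proof.
move=> k0; rewrite partial_barrier normrN !normrM.
rewrite (gtr0_norm (barrier_gt0 _ _ _)) ler_wpM2r// ?(ltW (barrier_gt0 _ _ _))//.
have r0 := rinv_gt0 x; have r1 := rinv_le1 x; have xr := coord_rinv_le1 i x.
have f0 : 0 <= rinv x ^+ 2 / 2 + kap * rinv x.
  by apply: addr_ge0; apply: mulr_ge0; rewrite ?sqr_ge0 ?(ltW r0).
rewrite (ger0_norm f0).
rewrite (_ : _ * _ = (`|coord i x| * rinv x) * (rinv x / 2 + kap)); last by ring.
rewrite (@le_trans _ _ (1 * (rinv x / 2 + kap)))// ?ler_wpM2r//; last by lra.
by rewrite addr_ge0// divr_ge0// ltW.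
Qed.

(** With r = 1 / rho, the quotient Delta W / W is
    kap^2 - kap r - r^2 / 4 - r^2 ((r + kap) r + (r / 2 + kap)^2). *)
Lemma laplacian_barrier_le c kap x : 0 <= kap ->
  \sum_(i < 3) partial i (partial i (barrier c kap)) x
    <= kap ^+ 2 * barrier c kap x.
Proof.
move=> k0; set W := barrier c kap; set r := rinv x.
have d2 i : partial i (partial i W) x = W x *
    (coord i x ^+ 2 * ((r + kap) * r ^+ 3 + (r ^+ 2 / 2 + kap * r) ^+ 2)
     - (r ^+ 2 / 2 + kap * r)).
  rewrite {1}partial_barrier.
  have dx := is_derive_coord i i x; rewrite eqxx in dx.
  have dr := is_derive_rinv i x.
  have dW := is_derive_barrier c kap i x.
  have -> : (fun y => - (coord i y * (rinv y ^+ 2 / 2 + kap * rinv y) * W y)) =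
      - (coord i * (2^-1 *: (rinv * rinv) + kap *: (rinv : E -> R)) * W).
    by apply/funext => y; rewrite !fctE /GRing.scale/= [_ / 2]mulrC -expr2.
  have dd := is_deriveN (is_deriveM (is_deriveM dx
    (is_deriveD (is_deriveZ 2^-1 (is_deriveM dr dr)) (is_deriveZ kap dr))) dW).
  rewrite /partial (@derive_val _ _ _ _ _ _ _ dd) !fctE /GRing.scale/= -/r -/W.
  rewrite -![_ *: _]/(_ * _).
  by field.
have S : \sum_(i < 3) coord i x ^+ 2 = sqn x - 1 by rewrite /sqn addrC addKr.
rewrite (eq_bigr _ (fun i _ => d2 i)) -mulr_sumr mulrC ler_wpM2r//.
  exact/ltW/barrier_gt0.
rewrite sumrB -mulr_suml S sumr_const card_ord.
have rs : r ^+ 2 * sqn x = 1 by exact: rinv_sqn.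
rewrite (_ : _ - _ = (r ^+ 2 * sqn x - r ^+ 2) *
    ((r + kap) * r + (r / 2 + kap) ^+ 2) - 3 * (r ^+ 2 / 2 + kap * r)); last by ring.
have r0 : 0 < r := rinv_gt0 x.
rewrite rs.
have : 0 <= r ^+ 2 * ((r + kap) * r + (r / 2 + kap) ^+ 2).
  by rewrite mulr_ge0 ?sqr_ge0// addr_ge0 ?sqr_ge0// mulr_ge0 ?addr_ge0// ltW.
have : 0 <= kap * r by rewrite mulr_ge0// ltW.
have : 0 <= r ^+ 2 by exact: sqr_ge0.
by lra.
Qed.

(** The exponential beats rho^6, and rho^6 is at least the product of the
    1 + x_i^2: a bound that separates the variables and is integrable. *)
Lemma barrier_decay c kap : 0 < kap -> exists2 D : R, 0 <= D &
  forall x, barrier c kap x <=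
    D * ((1 + x.1.1 ^+ 2)^-1 * (1 + x.1.2 ^+ 2)^-1 * (1 + x.2 ^+ 2)^-1).
Proof.
move=> k0; have N0 : 0 < 6`!%:R :> R by rewrite ltr0n fact_gt0.
have expN s : 0 <= s -> s ^+ 6 / 6`!%:R <= expR s :> R.
  by move=> s0; apply: le_trans (@expR_ge1Dxn R s 5 s0); rewrite lerDr.
move: (6`!%:R : R) N0 expN => N N0 expN.
have k60 : 0 < kap ^+ 6 by exact: exprn_gt0.
exists (expR c * N / kap ^+ 6) => [|x].
  by apply: divr_ge0 (ltW k60); rewrite mulr_ge0 ?expR_ge0 ?(ltW N0).
rewrite /barrier; set rho := Num.sqrt (sqn x).
have rho0 : 0 < rho := sqrt_sqn_gt0 x.
have l0 : 0 <= ln (sqn x) by rewrite ln_ge0// sqn_ge1.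
have h1 : expR (c - ln (sqn x) / 4 - kap * rho) <= expR c * expR (- (kap * rho)).
  by rewrite -expRD ler_expR lerB// gerBl divr_ge0.
apply: (le_trans h1); rewrite -!mulrA ler_wpM2l ?expR_ge0//.
have p0 : 0 < (kap * rho) ^+ 6 / N by rewrite divr_gt0// exprn_gt0// mulr_gt0.
rewrite expRN (@le_trans _ _ ((kap * rho) ^+ 6 / N)^-1)//.
  by rewrite lef_pV2 ?posrE ?expR_gt0// expN// mulr_ge0// ltW.
set y1 := 1 + x.1.1 ^+ 2; set y2 := 1 + x.1.2 ^+ 2; set y3 := 1 + x.2 ^+ 2.
have rho2 : rho ^+ 2 = 1 + (x.1.1 ^+ 2 + (x.1.2 ^+ 2 + x.2 ^+ 2)).
  rewrite sqr_sqrtr ?ltW ?sqn_gt0// /sqn !big_ord_recl big_ord0 addr0.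
  by rewrite /coord.
have a1 := sqr_ge0 x.1.1; have a2 := sqr_ge0 x.1.2; have a3 := sqr_ge0 x.2.
have y10 : 0 < y1 by rewrite /y1; lra.
have y20 : 0 < y2 by rewrite /y2; lra.
have y30 : 0 < y3 by rewrite /y3; lra.
have y_le : y1 * y2 * y3 <= rho ^+ 6.
  rewrite (_ : rho ^+ 6 = rho ^+ 2 * rho ^+ 2 * rho ^+ 2); last by ring.
  by rewrite !rho2 /y1 /y2 /y3; do 2! (apply: ler_pM; rewrite ?mulr_ge0//; try lra).
rewrite invf_div exprMn invfM.
rewrite (ler_pM2l N0) ler_pM2l ?invr_gt0// -!invfM.
by rewrite lef_pV2 ?posrE ?exprn_gt0//; [rewrite mulrA|rewrite !mulr_gt0].
Qed.

Lemma enorm_ge0 x : 0 <= enorm x. Proof. exact: sqrtr_ge0. Qed.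

Lemma sqn_enorm x : sqn x = 1 + enorm x ^+ 2.
Proof.
rewrite /enorm sqr_sqrtr ?addr_ge0 ?sqr_ge0// /sqn !big_ord_recl big_ord0 addr0.
by rewrite /coord/= -!addrA.
Qed.

(** The value of c makes the barrier equal to K on the sphere of radius r. *)
Definition barrier_on (K r kap : R) : E -> R :=
  barrier (ln K + ln (1 + r ^+ 2) / 4 + kap * Num.sqrt (1 + r ^+ 2)) kap.

Lemma barrier_on_ge (K r kap : R) x : 0 < K -> 0 <= kap -> enorm x <= r ->
  K <= barrier_on K r kap x.
Proof.
move=> K0 k0 xr; rewrite /barrier_on /barrier -[leLHS]lnK ?posrE// ler_expR.
have s_le : sqn x <= 1 + r ^+ 2.
  by rewrite sqn_enorm lerD2l lerXn2r// nnegrE ?enorm_ge0// (le_trans (enorm_ge0 x)).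
have r0 : 0 < 1 + r ^+ 2 by apply: lt_le_trans s_le; exact: sqn_gt0.
have : ln (sqn x) <= ln (1 + r ^+ 2) by rewrite ler_ln ?posrE ?sqn_gt0.
have : kap * Num.sqrt (sqn x) <= kap * Num.sqrt (1 + r ^+ 2).
  by rewrite ler_wpM2l// ler_wsqrtr.
by lra.
Qed.

Lemma barrier_on_le (K r kap : R) x : 0 < K -> 0 <= kap -> 0 < enorm x ->
  barrier_on K r kap x <= K * (1 + r ^+ 2) `^ 4^-1 * enorm x `^ (- 2^-1) *
    expR (- (kap * (enorm x - Num.sqrt (1 + r ^+ 2)))).
Proof.
move=> K0 k0 x0; set rho := Num.sqrt (1 + r ^+ 2).
have r0 : 0 < 1 + r ^+ 2 by have := sqr_ge0 r; lra.
have -> : K * (1 + r ^+ 2) `^ 4^-1 * enorm x `^ (- 2^-1) *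
    expR (- (kap * (enorm x - rho))) =
    expR (ln K + ln (1 + r ^+ 2) / 4 + kap * rho
          - ln (enorm x) / 2 - kap * enorm x).
  rewrite /powR !gt_eqF// -{1}(lnK (_ : K \is Num.pos)) ?posrE// -!expRD.
  by congr expR; ring.
rewrite /barrier_on /barrier ler_expR -/rho.
have s_le : enorm x ^+ 2 <= sqn x by rewrite sqn_enorm lerDr.
have : enorm x <= Num.sqrt (sqn x).
  by rewrite -(ger0_norm (enorm_ge0 x)) -sqrtr_sqr ler_wsqrtr.
move=> /(ler_wpM2l k0).
have : ln (enorm x) *+ 2 <= ln (sqn x).
  by rewrite -lnXn// ler_ln ?posrE ?sqn_gt0// exprn_gt0.
by rewrite mulr2n; lra.
Qed.

End barrier_theory.

(** * Measurability of continuous functions *)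

Section measurability.
Context {R : realType}.
Local Notation E := (R * R * R)%type.

(** The product sigma-algebra contains the rational boxes, and an open set is the
    union of the countably many rational boxes that it contains. *)
Lemma open_measurable_space (U : set E) : open U -> measurable U.
Proof.
move=> oU.
pose bx (q : (rat * rat * rat) * nat) : set E :=
  ball (ratr q.1.1.1 : R) q.2.+1%:R^-1 `*` ball (ratr q.1.1.2 : R) q.2.+1%:R^-1
  `*` ball (ratr q.1.2 : R) q.2.+1%:R^-1.
have mb (c e : R) : measurable (ball c e : set R).
  exact: measurable_ball.
have mbx q : measurable (bx q) by apply: measurableX => //; exact: measurableX.
have -> : U = \bigcup_(q in [set q | bx q `<=` U]) bx q.
  apply/seteqP; split; last by move=> x [q /= qU /qU].
  move=> x Ux; have [e /= e0 eU] : exists2 e : R, 0 < e & ball x e `<=` U.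
    by apply/nbhs_ballP; exact: open_nbhs_nbhs.
  have e20 : 0 < e / 2 by rewrite divr_gt0.
  have [n ne] : exists n, n.+1%:R^-1 < e / 2.
    have [N _ /(_ N)/(_ (leqnn _)) ?] := near_infty_natSinv_lt (PosNum e20).
    by exists N.
  have dq (y : R) : exists q : rat, ball (ratr q : R) n.+1%:R^-1 y.
    have : 0 < n.+1%:R^-1 :> R by rewrite invr_gt0 ltr0n.
    move: (n.+1%:R^-1 : R) => d d0.
    have [q] : exists q : rat, ratr q \in `]y - d, y + d[.
      have [|q] := @rat_in_itvoo R (y - d) (y + d); first by lra.
      by exists q.
    rewrite in_itv/= => /andP[q1 q2]; exists q.
    by rewrite /ball/= ltr_norml; apply/andP; split; lra.
  have [q1 h1] := dq x.1.1; have [q2 h2] := dq x.1.2; have [q3 h3] := dq x.2.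
  exists (q1, q2, q3, n) => //=.
  move=> z [[/= z1 z2] z3]; apply: eU.
  have tri (q : rat) (a b : R) : ball (ratr q : R) n.+1%:R^-1 a ->
      ball (ratr q : R) n.+1%:R^-1 b -> ball a e b.
    move=> /ball_sym ha hb; rewrite [e]splitr.
    by apply: (@ball_triangle _ _ (ratr q : R)); apply: le_ball (ltW ne) _ _.
  by split; [split|]; [exact: tri h1 z1|exact: tri h2 z2|exact: tri h3 z3].
have -> : \bigcup_(q in [set q | bx q `<=` U]) bx q =
    \bigcup_q (if `[< bx q `<=` U >] then bx q else set0).
  apply/seteqP; split => [x [q /= qU bq]|x [q _]].
    by exists q => //; rewrite asboolT.
  by case: ifPn => // /asboolP qU bq; exists q.
apply: countable_bigcupT_measurable => // q.
by case: ifPn.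
Qed.

Lemma continuous_measurable (f : E -> R) : continuous f -> measurable_fun setT f.
Proof.
move=> /continuousP cf; apply: (measurability _ (RGenOpens.measurableE R)).
move=> _ [_ [a [b ->] <-]]; rewrite setTI; apply: open_measurable_space.
exact/cf/interval_open.
Qed.

End measurability.

(** * Integrals of derivatives *)

Section compact_support.
Context {R : realType}.
Local Notation E := (R * R * R)%type.

Let idR : measurableTypeR R -> R := idfun.

Let measurable_idR : measurable_fun setT idR.
Proof. by move=> _ B mB; rewrite setTI. Qed.

(** leb1 is the image of the Lebesgue measure under the identity map between the
    two measurable structures on the line. *)
Lemma ge0_integral_leb1 (f : R -> \bar R) : measurable_fun setT f ->
  (forall t, 0 <= f t)%E ->
  (\int[leb1]_t f t = \int[lebesgue_measure]_t f t)%E.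
Proof.
move=> mf f0.
transitivity (\int[pushforward (@lebesgue_measure R) idR]_t f t)%E.
  exact: eq_measure_integral.
by rewrite ge0_integral_pushforward.
Qed.

Lemma integral_leb1 (f : R -> \bar R) : measurable_fun setT f ->
  (lebesgue_measure : set (measurableTypeR R) -> \bar R).-integrable setT f ->
  (\int[leb1]_t f t = \int[lebesgue_measure]_t f t)%E.
Proof.
move=> mf fi.
transitivity (\int[pushforward (@lebesgue_measure R) idR]_t f t)%E.
  exact: eq_measure_integral.
by rewrite integral_pushforward.
Qed.

Lemma bounded_support_integrable d (T : measurableType d)
    (mu : {measure set T -> \bar R}) (A : set T) (f : T -> R) (M : R) :
  measurable A -> (mu A < +oo)%E -> measurable_fun setT f ->
  (forall x, `|f x| <= M) -> (forall x, ~ A x -> f x = 0) ->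
  mu.-integrable setT (EFin \o f).
Proof.
move=> mA Afin mf fM f0.
have -> : EFin \o f = (EFin \o f) \_ A.
  by apply/funext => x; rewrite patchE; case: ifPn => // /negP; rewrite inE => /f0 /= ->.
apply/(integrable_mkcond _ mA).1.
apply: measurable_bounded_integrable => //; first exact: measurable_funTS.
exists M; split; first exact: num_real.
by move=> y My x _; apply: le_trans (ltW My); exact: fM.
Qed.

(** The fundamental theorem of calculus on an interval that contains the
    support. *)
Lemma integral1_derive_eq0 (f df : R -> R) (r M : R) : 0 < r ->
  continuous df -> (forall t, `|df t| <= M) -> (forall t : R, is_derive t 1 f (df t)) ->
  (forall t, r < `|t| -> f t = 0) ->
  (\int[leb1]_t (df t)%:E = 0)%E.
Proof.
move=> r0 cdf dfM fdf f0.
have cf : continuous f.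
  move=> t; apply: differentiable_continuous; apply/derivable1_diffP.
  by have [] := fdf t.
have df0 t : r < `|t| -> df t = 0.
  move=> rt; have [_ <-] := fdf t.
  rewrite -(derive_cst (0 : R) t 1); apply: near_eq_derive.
  near=> s; apply: f0; near: s.
  by apply: (cvgr_gt `|t|) => //; apply: cvg_norm; exact: cvg_id.
rewrite integral_leb1; last 2 first.
- by apply/measurable_EFinP; exact: continuous_measurable_fun.
- have mI : measurable (`[- r, r]%classic : set (measurableTypeR R)).
    exact: measurable_itv.
  have lI : (lebesgue_measure (`[(- r)%R, r]%classic : set R) < +oo)%E.
    by rewrite lebesgue_measure_itv/=; case: ifPn => // _; rewrite -EFinB ltry.
  apply: (bounded_support_integrable mI _ _ dfM).
  + exact: lI.
  + exact: continuous_measurable_fun.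
  + move=> t /= /negP; rewrite in_itv/= => h; apply: df0; rewrite ltNge.
    by rewrite ler_norml.
have -> : (fun t => (df t)%:E) = (fun t => (df t)%:E) \_ `[- (r + 1), r + 1].
  apply/funext => t; rewrite patchE; case: ifPn => // /negP.
  rewrite inE/= in_itv/= => h; rewrite df0// ltNge; apply/negP.
  by rewrite ler_norml => /andP[h1 h2]; apply: h; apply/andP; split; lra.
rewrite -integral_mkcond (@continuous_FTC2 _ df f)//.
- by rewrite !f0 ?subee// ?normrN ger0_norm; lra.
- by lra.
- exact: continuous_subspaceT.
- split; first by move=> t _; have [] := fdf t.
    exact/cvg_at_right_filter/cf.
  exact/cvg_at_left_filter/cf.
- by move=> t _; rewrite derive1E; have [] := fdf t.
Unshelve. all: by end_near. Qed.

Definition box (r : R) : set E := `[- r, r] `*` `[- r, r] `*` `[- r, r].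

Lemma measurable_box r : measurable (box r).
Proof. by apply: measurableX; [apply: measurableX|]; exact: measurable_itv. Qed.

Lemma leb1_itv_lty (a b : R) : (leb1 `[a, b] < +oo)%E.
Proof.
rewrite /leb1 lebesgue_measure_itv/=; case: ifPn => // _.
by rewrite -EFinB ltry.
Qed.

Lemma leb2_box_lty (r : R) : (leb2 (`[(- r)%R, r] `*` `[(- r)%R, r]) < +oo)%E.
Proof.
rewrite /leb2 product_measure1E//; try exact: measurable_itv.
by rewrite lte_mul_pinfty// ?leb1_itv_lty// ge0_fin_numE// leb1_itv_lty.
Qed.

Lemma leb3_box_lty r : (leb3 (box r) < +oo)%E.
Proof.
rewrite /leb3 /box product_measure1E//; try exact: measurable_itv.
  by rewrite lte_mul_pinfty// ?leb1_itv_lty// ge0_fin_numE// leb2_box_lty.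
by apply: measurableX; exact: measurable_itv.
Qed.

End compact_support.

(** * Test functions *)

Section test_functions.
Context {R : realType}.
Local Notation E := (R * R * R)%type.
Implicit Types (x v : E) (f g : E -> R) (i j : 'I_3).

Lemma coord_le_enorm i x : `|coord i x| <= enorm x.
Proof.
have e2 : \sum_(j < 3) coord j x ^+ 2 = enorm x ^+ 2.
  by have := sqn_enorm x; rewrite /sqn => /addrI.
rewrite -(ger0_norm (enorm_ge0 x)) -!sqrtr_sqr ler_wsqrtr// -e2 (bigD1 i)//= lerDl.
by rewrite sumr_ge0// => j _; exact: sqr_ge0.
Qed.

Lemma notin_box r x : ~ box r x -> r < enorm x.
Proof.
move=> nb; rewrite ltNge; apply/negP => xr; apply: nb.
have h i : - r <= coord i x <= r.
  by rewrite -ler_norml (le_trans (coord_le_enorm i x)).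
have h0 := h ord0; have h1 := h (Ordinal (isT : 1 < 3)%N).
have h2 := h (Ordinal (isT : 2 < 3)%N).
by split; [split|]; rewrite /= in_itv; [exact: h0|exact: h1|exact: h2].
Qed.

Lemma test_funW f : test_fun f ->
  exists2 r : R, 0 < r & forall x, r < enorm x -> f x = 0.
Proof.
move=> [_ [r fr]]; exists (Num.max r 1); first by rewrite lt_max ltr01 orbT.
by move=> x; rewrite gt_max => /andP[/fr].
Qed.

Lemma test_fun_continuous f : test_fun f -> continuous f.
Proof. by move=> [/smooth_continuous]. Qed.

Lemma test_fun_measurable f : test_fun f -> measurable_fun setT f.
Proof. by move=> /test_fun_continuous/continuous_measurable. Qed.

Lemma test_fun_bounded f : test_fun f -> exists M, forall x, `|f x| <= M.
Proof.
move=> tf; have [r r0 fr] := test_funW tf.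
have cb : compact (box r).
  by apply: compact_setX; [apply: compact_setX|]; exact: segment_compact.
have b0 : box r !=set0.
  by exists (0, 0, 0); split; [split|]; rewrite /= in_itv/= oppr_cp0 ltW.
have cn : {within box r, continuous (fun x => `|f x|)}.
  by apply: continuous_subspaceT => x; apply: cvg_norm; exact: test_fun_continuous.
have [c cbox cmax] := compact_EVT_max b0 cb cn.
exists `|f c| => x; have [xb|] := pselect (box r x).
  by apply: cmax; rewrite inE.
by move=> /notin_box/fr ->; rewrite normr0.
Qed.

Lemma test_fun_integrable f : test_fun f -> leb3.-integrable setT (EFin \o f).
Proof.
move=> tf; have [r r0 fr] := test_funW tf; have [M fM] := test_fun_bounded tf.
apply: (bounded_support_integrable (measurable_box r) (leb3_box_lty r) _ fM).
  exact: test_fun_measurable.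
by move=> x /notin_box/fr.
Qed.

Lemma test_fun_partial f i : test_fun f -> test_fun (partial i f).
Proof.
move=> tf; have [r r0 fr] := test_funW tf; split.
  exact/smooth_partial/tf.1.
exists r => x rx; rewrite /partial -(derive_cst (0 : R) x (basis3 i)).
apply: near_eq_derive.
have : \forall y \near x, 1 + r ^+ 2 < sqn y.
  have /cvgr_gt := @continuous_sqn R x; apply.
  by rewrite sqn_enorm ltrD2l ltrXn2r// ?nnegrE ?enorm_ge0 ?ltW.
apply: filterS => y; rewrite sqn_enorm ltrD2l => h; apply: fr.
rewrite ltNge; apply/negP => yr; move: h; rewrite ltNge => /negP; apply.
by rewrite lerXn2r ?nnegrE ?enorm_ge0 ?(ltW r0).
Qed.

Lemma is_derive_curve f v (gam : R -> E) (t l : R) :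
  (forall h, gam (h + t) = h *: v + gam t) ->
  is_derive (gam t) v f l -> is_derive t 1 (f \o gam) l.
Proof.
move=> gE [df <-].
have e : (fun h : R => h^-1 *: ((f \o gam) (h *: 1 + t) - (f \o gam) t)) =
         (fun h : R => h^-1 *: (f (h *: v + gam t) - f (gam t))).
  by apply/funext => h; rewrite [h *: 1]mulr1 /= gE.
by split; rewrite /derivable /derive e.
Qed.

(** By Fubini, the coordinate of the derivative can be integrated first. *)
Lemma integral_partial_eq0 f i : test_fun f ->
  (\int[leb3]_x (partial i f x)%:E = 0)%E.
Proof.
move=> tf; have tp := test_fun_partial i tf.
have [r r0 fr] := test_funW tf; have [r' r'0 pr] := test_funW tp.
have [M pM] := test_fun_bounded tp.
have mp := test_fun_measurable tp.
have cp := test_fun_continuous tp.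
have ip := test_fun_integrable tp.
have line (gam : R -> E) : continuous gam ->
    (forall t h, gam (h + t) = h *: basis3 i + gam t) ->
    (forall t, coord i (gam t) = t) ->
    (\int[leb1]_t (partial i f (gam t))%:E = 0)%E.
  move=> cg gE gi; apply: (@integral1_derive_eq0 _ (f \o gam) _ r M) => //.
  - by move=> t; apply: (continuous_comp (cg t)); exact: cp.
  - move=> t; apply: (@is_derive_curve _ (basis3 i)) => //.
    exact: is_derive_partial tf.1.
  - move=> t rt /=; apply: fr; apply: (lt_le_trans rt).
    by rewrite -[t in leLHS]gi; exact: coord_le_enorm.
have slice (t : R) :
    leb2.-integrable setT (EFin \o (fun y : R * R => partial i f (y, t))).
  have m2 : measurable (`[- r', r'] `*` `[- r', r'] : set (R * R)).
    by apply: measurableX; exact: measurable_itv.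
  apply: (bounded_support_integrable m2 (leb2_box_lty r') _ (fun y => pM (y, t))).
    exact: measurableT_comp mp (pair2_measurable t).
  move=> y yb; apply/pr/notin_box => -[[/= h1 h2] _]; apply: yb; split => //.
have cpair (T U : topologicalType) (a : R -> T) (b : R -> U) :
    continuous a -> continuous b -> continuous (fun t => (a t, b t)).
  by move=> ca cb t; exact: cvg_pair (ca t) (cb t).
have cid : continuous (@id R) by move=> t; exact: cvg_id.
have cc (T : topologicalType) (a : T) : continuous (fun _ : R => a).
  by move=> t; exact: cvg_cst.
have eq3 (a b : E) :
    a.1.1 = b.1.1 -> a.1.2 = b.1.2 -> a.2 = b.2 -> a = b.
  by case: a => [[? ?] ?]; case: b => [[? ?] ?] /= -> -> ->.
have [i0|i0] := eqVneq (val i) 2%N.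
  rewrite -(integral12_prod_meas1 ip); apply: integral0_eq => y _.
  apply: (line (fun t => (y, t))).
  - exact: cpair.
  - by move=> t h; rewrite /basis3 i0; apply: eq3; rewrite /= ?[_ *: 1]mulr1 ?scaler0 ?add0r.
  - by move=> t; rewrite /coord i0.
rewrite -(integral21_prod_meas1 ip); apply: integral0_eq => t _.
have [i1|i1] := eqVneq (val i) 1%N.
  rewrite /fubini_G -(integral12_prod_meas1 (slice t)); apply: integral0_eq => y _.
  apply: (line (fun s => (y, s, t))).
  - by apply: (@cpair) => //; exact: (@cpair).
  - by move=> s h; rewrite /basis3 i1; apply: eq3; rewrite /= ?[_ *: 1]mulr1 ?scaler0 ?add0r.
  - by move=> s; rewrite /coord i1.
have i2 : val i = 0%N by move: i0 i1; case: (i) => -[|[|[|]]].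
rewrite /fubini_G -(integral21_prod_meas1 (slice t)); apply: integral0_eq => y _.
apply: (line (fun s => (s, y, t))).
- by apply: (@cpair) => //; exact: (@cpair).
- by move=> s h; rewrite /basis3 i2; apply: eq3; rewrite /= ?[_ *: 1]mulr1 ?scaler0 ?add0r.
- by move=> s; rewrite /coord i2.
Qed.

End test_functions.

(** * Convergence in mean *)

Section convergence_in_mean.
Context d (T : measurableType d) (R : realType).
Context (mu : {measure set T -> \bar R}).
Implicit Types (f g F : T -> R) (a c : nat -> \bar R) (k : nat).
Local Open Scope ereal_scope.

Lemma cvge0P a : (forall n, 0 <= a n) ->
  a @ \oo --> 0 <-> forall e : R, (0 < e)%R -> \forall n \near \oo, a n <= e%:E.
Proof.
move=> a0; split.
  move=> /fine_cvgP[afin /cvgr0Pnorm_le acvg] e e0.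
  near=> n; have an : a n \is a fin_num by near: n.
  rewrite -(fineK an) lee_fin (le_trans (ler_norm _))//.
  by near: n; exact: acvg.
move=> h; apply/fine_cvgP; split.
  have := h _ ltr01; apply: filterS => n an1.
  by rewrite ge0_fin_numE// (le_lt_trans an1)// ltry.
apply/cvgr0Pnorm_le => e e0; have := h _ e0; apply: filterS => n ane /=.
rewrite ger0_norm ?fine_ge0// -lee_fin fineK//.
by rewrite ge0_fin_numE// (le_lt_trans ane)// ltry.
Unshelve. all: by end_near. Qed.

Lemma cvge0_poweR a (r : R) : (0 < r)%R -> (forall n, 0 <= a n) ->
  a @ \oo --> 0 -> (fun n => a n `^ r) @ \oo --> 0.
Proof.
move=> r0 a0 /(cvge0P a0) ha; apply/cvge0P => [n|e e0]; first exact: poweR_ge0.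
have := ha (e `^ r^-1)%R (powR_gt0 _ e0); apply: filterS => n an.
have -> : e%:E = (e `^ r^-1)%:E `^ r.
  by rewrite poweR_EFin -powRrM mulVf ?gt_eqF// powRr1// ltW.
apply: gt0_ler_poweR an; first exact: ltW.
  by rewrite in_itv/= a0 leey.
by rewrite in_itv/= leey lee_fin powR_ge0.
Qed.

(** The form in which the limits below are obtained: an arbitrarily small constant
    is paid to compare c with a multiple of a. *)
Lemma cvge0_eps a c : (forall n, 0 <= a n) -> (forall n, 0 <= c n) ->
  a @ \oo --> 0 ->
  (forall e : R, (0 < e)%R ->
    exists2 K : R, (0 < K)%R & forall n, c n <= e%:E + K%:E * a n) ->
  c @ \oo --> 0.
Proof.
move=> a0 c0 /(cvge0P a0) ha h; apply/cvge0P => // e e0.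
have e20 : (0 < e / 2)%R by rewrite divr_gt0.
have [K K0 hK] := h _ e20.
have := ha (e / 2 / K)%R (divr_gt0 e20 K0); apply: filterS => n an.
apply: (le_trans (hK n)); rewrite [in leRHS](splitr e) EFinD leeD2l//.
apply: (@le_trans _ _ (K%:E * (e / 2 / K)%:E)); first by rewrite lee_pmul2l.
by rewrite -EFinM lee_fin mulrC divfK// gt_eqF.
Qed.

(** Moments rather than norms: integrals of powers inherit pointwise bounds
    directly, and the triangle inequality is only needed up to a constant. *)
Definition moment k f := \int[mu]_x (`|f x| ^+ k)%:E.

Lemma moment_ge0 k f : 0 <= moment k f.
Proof. by apply: integral_ge0 => x _; rewrite lee_fin exprn_ge0. Qed.

Lemma measurable_normX k f : measurable_fun setT f ->
  measurable_fun setT (fun x => (`|f x| ^+ k)%:E).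
Proof.
move=> mf; apply/measurable_EFinP; apply: measurable_funX.
exact: measurableT_comp.
Qed.

Lemma moment_Lnorm k f : (0 < k)%N ->
  moment k f = 'N[mu]_(k%:R%:E)[EFin \o f] `^ k%:R.
Proof.
move=> k0; rewrite poweR_Lnorm; last by rewrite pnatr_eq0 -lt0n.
by apply: eq_integral => x _ /=; rewrite powR_mulrn.
Qed.

Lemma Lnorm_moment k f : (0 < k)%N ->
  'N[mu]_(k%:R%:E)[EFin \o f] = moment k f `^ k%:R^-1.
Proof.
move=> k0; rewrite moment_Lnorm// -poweRrM mulfV ?pnatr_eq0 -?lt0n//.
by rewrite poweRe1// Lnorm_ge0.
Qed.

Lemma Lnorm_cvg0 k (f : nat -> T -> R) : (0 < k)%N ->
  (fun n => 'N[mu]_(k%:R%:E)[EFin \o f n]) @ \oo --> 0 <->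
  (fun n => moment k (f n)) @ \oo --> 0.
Proof.
move=> k0; split=> h.
  under eq_fun do rewrite (moment_Lnorm _ k0).
  by apply: cvge0_poweR => // [|n]; rewrite ?ltr0n// Lnorm_ge0.
under eq_fun do rewrite (Lnorm_moment _ k0).
by apply: cvge0_poweR => // [|n]; rewrite ?invr_gt0 ?ltr0n// moment_ge0.
Qed.

Lemma le_ae_integrable f g : measurable_fun setT f ->
  {ae mu, forall x, (`|f x| <= g x)%R} ->
  mu.-integrable setT (EFin \o g) -> mu.-integrable setT (EFin \o f).
Proof.
move=> mf fg /integrableP[mg ig]; apply/integrableP; split.
  exact/measurable_EFinP.
apply: le_lt_trans ig; apply: ae_ge0_le_integral => //.
- by apply: measurableT_comp => //; exact/measurable_EFinP.
- by apply: measurableT_comp mg.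
- by apply: filterS fg => x h _ /=; rewrite lee_fin (le_trans h)// ler_norm.
Qed.

Lemma moment_integrable k f : measurable_fun setT f -> moment k f < +oo ->
  mu.-integrable setT (EFin \o (fun x => `|f x| ^+ k)%R).
Proof.
move=> mf fk; apply/integrableP; split; first exact: measurable_normX.
by under eq_integral => x _ do rewrite /= ger0_norm ?exprn_ge0//.
Qed.

Lemma integrable_moment k f :
  mu.-integrable setT (EFin \o (fun x => `|f x| ^+ k)%R) -> moment k f < +oo.
Proof.
move=> /integrableP[_]; apply: le_lt_trans.
by under [leRHS]eq_integral => x _ do rewrite /= ger0_norm ?exprn_ge0//.
Qed.

Lemma integrableM2 f g : measurable_fun setT f -> measurable_fun setT g ->
  moment 2 f < +oo -> moment 2 g < +oo ->
  mu.-integrable setT (EFin \o (fun x => f x * g x)%R).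
Proof.
move=> mf mg f2 g2.
have := integrableD measurableT (moment_integrable mf f2) (moment_integrable mg g2).
apply: le_integrable => //; first exact/measurable_EFinP/measurable_funM.
move=> x _; rewrite lee_fin; apply: le_trans (ler_norm _) => /=.
have : (0 <= `|f x| * `|g x|)%R by rewrite mulr_ge0.
have := sqr_ge0 (`|f x| - `|g x|)%R; rewrite sqrrB normrM mulr2n.
by move: (`|f x|)%R (`|g x|)%R => s t; lra.
Qed.

Lemma momentD_le k f g : measurable_fun setT f -> measurable_fun setT g ->
  moment k (fun x => f x + g x)%R <= (2 ^+ k)%:E * (moment k f + moment k g).
Proof.
move=> mf mg; have mF := measurable_normX k mf; have mG := measurable_normX k mg.
rewrite /moment -ge0_integralD// -ge0_integralZl_EFin//; last 2 first.
  by move=> x _; rewrite -EFinD lee_fin addr_ge0 ?exprn_ge0.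
  exact: emeasurable_funD.
apply: ge0_le_integral => //.
- by apply: measurable_normX; exact: measurable_funD.
- by apply: measurable_funeM; exact: emeasurable_funD.
- move=> x _; rewrite lee_fin.
  wlog gf : f g {mf mg mF mG} / (`|g x| <= `|f x|)%R.
    move=> h; have [/h//|/ltW/h] := leP `|g x|%R `|f x|%R.
    by rewrite (addrC (g x)) (addrC (_ ^+ k)%R).
  apply: (@le_trans _ _ ((2 * `|f x|) ^+ k)%R).
    rewrite lerXn2r ?nnegrE ?mulr_ge0//.
    by rewrite (le_trans (ler_normD _ _))// mulr_natl mulr2n lerD2l.
  by rewrite exprMn ler_wpM2l ?exprn_ge0// lerDl exprn_ge0.
Qed.

Lemma integral_norm_lty F : mu.-integrable setT (EFin \o F) ->
  \int[mu]_x (`|F x|)%:E < +oo.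
Proof. by move=> /integrableP[]. Qed.

(** By s t <= delta s^2 + t^2 / delta. *)
Lemma cvg_integral_normM F (f : nat -> T -> R) :
  measurable_fun setT F -> (forall n, measurable_fun setT (f n)) ->
  moment 2 F < +oo -> (fun n => moment 2 (f n)) @ \oo --> 0 ->
  (fun n => \int[mu]_x (`|F x * f n x|)%:E) @ \oo --> 0.
Proof.
move=> mF mf F2 f2; apply: cvge0_eps f2 _ => [n|n|e e0].
- exact: moment_ge0.
- by apply: integral_ge0 => x _; rewrite lee_fin.
have F2fin : moment 2 F \is a fin_num by rewrite ge0_fin_numE// moment_ge0.
pose B := fine (moment 2 F).
have B0 : (0 <= B)%R by rewrite fine_ge0// moment_ge0.
have dl0 : (0 < e / (B + 1))%R by rewrite divr_gt0// ltr_pwDr.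
exists (e / (B + 1))^-1%R => [|n]; first by rewrite invr_gt0.
set dl := (e / (B + 1))%R in dl0 *.
have dlB : (dl * B <= e)%R.
  by rewrite /dl mulrAC ler_pdivrMr ?ltr_pwDr// mulrDr mulr1 lerDl ltW.
apply: (@le_trans _ _ (\int[mu]_x (dl%:E * (`|F x| ^+ 2)%:E
                        + dl^-1%:E * (`|f n x| ^+ 2)%:E))).
  apply: ge0_le_integral => //.
  - by apply/measurable_EFinP; apply: measurableT_comp => //; exact: measurable_funM.
  - by apply: emeasurable_funD; apply: measurable_funeM; exact: measurable_normX.
  - move=> x _; rewrite -!EFinM -EFinD lee_fin normrM.
    move: (`|F x|)%R (`|f n x|)%R (normr_ge0 (F x)) (normr_ge0 (f n x)) => s t s0 t0.
    have -> : (dl * s ^+ 2 + dl^-1 * t ^+ 2 =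
        dl^-1 * (dl * s - t) ^+ 2 + (s * t + s * t))%R.
      by field; rewrite gt_eqF.
    have st0 : (0 <= s * t)%R by exact: mulr_ge0.
    by rewrite addrA lerDr addr_ge0// mulr_ge0 ?sqr_ge0// invr_ge0 ltW.
rewrite ge0_integralD//; last 4 first.
- by move=> x _; rewrite mule_ge0 ?lee_fin ?exprn_ge0// ltW.
- by apply: measurable_funeM; exact: measurable_normX.
- by move=> x _; rewrite mule_ge0 ?lee_fin ?exprn_ge0// invr_ge0 ltW.
- by apply: measurable_funeM; exact: measurable_normX.
rewrite ge0_integralZl_EFin ?(ltW dl0)//; last exact: measurable_normX.
rewrite ge0_integralZl_EFin ?invr_ge0 ?(ltW dl0)//; last exact: measurable_normX.
by rewrite leeD2r// -/(moment 2 F) -(fineK F2fin) -EFinM lee_fin.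
Qed.

(** The weight only has to be bounded and integrable, because t is at most
    delta + t^6 / delta^5 for every positive delta. *)
Lemma integral_norm_le_moment6 F (M e : R) : measurable_fun setT F ->
  (forall x, `|F x| <= M)%R -> mu.-integrable setT (EFin \o F) -> (0 < e)%R ->
  exists2 K : R, (0 < K)%R & forall h, measurable_fun setT h ->
    \int[mu]_x (`|F x * h x|)%:E <= e%:E + K%:E * moment 6 h.
Proof.
move=> mF FM /integral_norm_lty iF e0.
have iF0 : 0 <= \int[mu]_x (`|F x|)%:E.
  by apply: integral_ge0 => x _; rewrite lee_fin.
pose B := fine (\int[mu]_x (`|F x|)%:E).
have B0 : (0 <= B)%R by exact: fine_ge0.
have B10 : (0 < B + 1)%R by rewrite ltr_pwDr.
have dl0 : (0 < e / (B + 1))%R by exact: divr_gt0.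
set dl := (e / (B + 1))%R in dl0 *.
have dlB : (dl * B <= e)%R.
  by rewrite /dl mulrAC ler_pdivrMr// mulrDr mulr1 lerDl ltW.
have K0 : (0 < (`|M| + 1) / dl ^+ 5)%R.
  by rewrite divr_gt0 ?exprn_gt0// ltr_pwDr.
exists ((`|M| + 1) / dl ^+ 5)%R => // h mh.
set K := ((`|M| + 1) / dl ^+ 5)%R in K0 *.
have mFn : measurable_fun setT (fun x => (`|F x|)%:E).
  by apply/measurable_EFinP; exact: measurableT_comp.
apply: (@le_trans _ _ (\int[mu]_x (dl%:E * (`|F x|)%:E
                        + K%:E * (`|h x| ^+ 6)%:E))).
  apply: ge0_le_integral => //.
  - by apply/measurable_EFinP; apply: measurableT_comp => //; exact: measurable_funM.
  - apply: emeasurable_funD; apply: measurable_funeM => //.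
    exact: measurable_normX.
  - move=> x _; rewrite -!EFinM -EFinD lee_fin normrM.
    have FM1 : (`|F x| <= `|M| + 1)%R.
      by rewrite (le_trans (FM x))// (le_trans (ler_norm _))// lerDl.
    move: (`|F x|)%R (`|h x|)%R (normr_ge0 (F x)) (normr_ge0 (h x)) FM1.
    move=> s t s0 t0 sM; have [tdl|dlt] := leP t dl.
      rewrite (@le_trans _ _ (dl * s)%R)//.
        by rewrite mulrC ler_wpM2r.
      by rewrite lerDl mulr_ge0 ?exprn_ge0// ltW.
    apply: (@le_trans _ _ (K * t ^+ 6)%R); last first.
      by rewrite lerDr mulr_ge0// ltW.
    rewrite /K -mulrA ler_pM// mulrC ler_pdivlMr ?exprn_gt0//.
    by rewrite [leRHS]exprS ler_wpM2l// lerXn2r ?nnegrE// ltW.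
rewrite ge0_integralD//; last 4 first.
- by move=> x _; rewrite mule_ge0 ?lee_fin// ltW.
- exact: measurable_funeM.
- by move=> x _; rewrite mule_ge0 ?lee_fin ?exprn_ge0// ltW.
- by apply: measurable_funeM; exact: measurable_normX.
rewrite ge0_integralZl_EFin ?(ltW dl0)//.
rewrite ge0_integralZl_EFin ?(ltW K0)//; last exact: measurable_normX.
rewrite leeD2r// -[X in _ * X]fineK; last by rewrite ge0_fin_numE.
by rewrite -EFinM lee_fin.
Qed.

Lemma cvg_integral_norm_bounded F (f : nat -> T -> R) (M : R) :
  measurable_fun setT F -> (forall x, `|F x| <= M)%R ->
  mu.-integrable setT (EFin \o F) -> (forall n, measurable_fun setT (f n)) ->
  (fun n => moment 6 (f n)) @ \oo --> 0 ->
  (fun n => \int[mu]_x (`|F x * f n x|)%:E) @ \oo --> 0.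
Proof.
move=> mF FM iF mf f6; apply: cvge0_eps f6 _ => [n|n|e e0].
- exact: moment_ge0.
- by apply: integral_ge0 => x _; rewrite lee_fin.
have [K K0 hK] := integral_norm_le_moment6 mF FM iF e0.
by exists K => // n; exact: hK.
Qed.

Lemma integral_tail_cvg0 F : (forall x, 0 <= F x)%R ->
  mu.-integrable setT (EFin \o F) ->
  (fun m : nat => \int[mu]_x (F x * \1_[set y | (m%:R < F y)%R] x)%:E) @ \oo --> 0.
Proof.
move=> F0 iF; have [/measurable_EFinP mF _] := integrableP _ _ _ iF.
have mI (m : nat) : measurable_fun setT (\1_[set y | (m%:R < F y)%R] : T -> R).
  apply: measurable_indic; have := mF measurableT `]m%:R, +oo[%classic (measurable_itv _).
  rewrite setTI; congr measurable; apply/seteqP.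
  by split => x /=; rewrite in_itv/= andbT.
have [] := @dominated_convergence _ _ _ mu setT measurableT
  (fun (m : nat) x => (F x * \1_[set y | (m%:R < F y)%R] x)%:E) (cst 0) (EFin \o F) => //.
- by move=> m; apply/measurable_EFinP; exact: measurable_funM.
- apply: aeW => x _; apply/fine_cvgP; split; first exact: nearW.
  apply: cvg_near_cst.
  have [N FN] : exists N : nat, (F x <= N%:R)%R.
    by exists (Num.bound (F x)); rewrite ltW// archi_boundP.
  exists N => // m /= Nm; rewrite indicE memNset ?mulr0//=.
  by apply/negP; rewrite -leNgt (le_trans FN)// ler_nat.
- apply: aeW => x m _; rewrite /= lee_fin ger0_norm; last first.
    by rewrite mulr_ge0.
  by rewrite ler_piMr// indicE lern1 leq_b1.
- by move=> _ _; rewrite integral_cst// mul0e.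
Qed.

(** Bounding b twice replaces the boundedness of the weight: the weight is
    truncated, and its tail is paired with the uniform bound. *)
Lemma cvg_integral_norm_min F (b f : nat -> T -> R) (C : R) :
  (forall x, 0 <= F x)%R -> mu.-integrable setT (EFin \o F) ->
  (forall n, measurable_fun setT (b n)) -> (forall n, measurable_fun setT (f n)) ->
  (forall n x, `|b n x| <= C)%R -> (forall n x, `|b n x| <= C * `|f n x|)%R ->
  (fun n => moment 6 (f n)) @ \oo --> 0 ->
  (fun n => \int[mu]_x (`|F x * b n x|)%:E) @ \oo --> 0.
Proof.
move=> F0 iF mb mf bC bCf f6; apply: cvge0_eps f6 _ => [n|n|e e0].
- exact: moment_ge0.
- by apply: integral_ge0 => x _; rewrite lee_fin.
have [/measurable_EFinP mF _] := integrableP _ _ _ iF.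
wlog C0 : C bC bCf / (0 < C)%R.
  move=> h; apply: (h (`|C| + 1)%R); last by rewrite ltr_pwDr.
    by move=> n x; rewrite (le_trans (bC n x))// (le_trans (ler_norm _))// lerDl.
  move=> n x; rewrite (le_trans (bCf n x))// ler_wpM2r//.
  by rewrite (le_trans (ler_norm _))// lerDl.
have eC : (0 < e / 2 / C)%R by rewrite !divr_gt0.
have tail0 (m : nat) : 0 <= \int[mu]_x (F x * \1_[set y | (m%:R < F y)%R] x)%:E.
  by apply: integral_ge0 => x _; rewrite lee_fin mulr_ge0.
have /(cvge0P tail0)/(_ _ eC)[m _ /(_ m (leqnn m)) tailm] := integral_tail_cvg0 F0 iF.
have mA : measurable [set y | (m%:R < F y)%R].
  have := mF measurableT `]m%:R, +oo[%classic (measurable_itv _).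
  rewrite setTI; congr measurable; apply/seteqP.
  by split => x /=; rewrite in_itv/= andbT.
set A := [set y | (m%:R < F y)%R] in mA tailm *.
pose Fm := (fun x => F x * \1_(~` A) x)%R.
have mFm : measurable_fun setT Fm.
  by apply: measurable_funM => //; apply: measurable_indic; exact: measurableC.
have Fm0 x : (0 <= Fm x)%R by rewrite mulr_ge0.
have FmF x : (Fm x <= F x)%R by rewrite ler_piMr// indicE lern1 leq_b1.
have iFm : mu.-integrable setT (EFin \o Fm).
  apply: le_integrable iF => //; first exact/measurable_EFinP.
  by move=> x _ /=; rewrite lee_fin !ger0_norm.
have Fmm x : (`|Fm x| <= m%:R)%R.
  rewrite ger0_norm// /Fm indicE; have [xA|xA] := boolP (x \in ~` A).
    by rewrite mulr1 leNgt; move: xA; rewrite inE => /negP.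
  by rewrite mulr0.
have [K K0 hK] := integral_norm_le_moment6 mFm Fmm iFm eC.
exists (C * K)%R => [|n]; first exact: mulr_gt0.
have mIA : measurable_fun setT (fun x => (F x * \1_A x)%:E).
  by apply/measurable_EFinP; apply: measurable_funM => //; exact: measurable_indic.
have mFf : measurable_fun setT (fun x => (`|Fm x * f n x|)%:E).
  by apply/measurable_EFinP; apply: measurableT_comp => //; exact: measurable_funM.
apply: (@le_trans _ _ (\int[mu]_x (C%:E * ((F x * \1_A x)%:E
                        + (`|Fm x * f n x|)%:E)))).
  apply: ge0_le_integral => //.
  - by apply/measurable_EFinP; apply: measurableT_comp => //; exact: measurable_funM.
  - by apply: measurable_funeM; exact: emeasurable_funD.
  - move=> x _; rewrite -EFinD -EFinM lee_fin normrM (ger0_norm (F0 x)).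
    rewrite normrM (ger0_norm (Fm0 x)) /Fm !indicE in_setC.
    case: (x \in A); rewrite /= ?mulr0 ?mulr1 ?mul0r ?addr0 ?add0r.
      by rewrite mulrC ler_wpM2r.
    by rewrite mulrCA ler_wpM2l.
rewrite ge0_integralZl_EFin ?(ltW C0)//; last 2 first.
- by move=> x _; rewrite -EFinD lee_fin addr_ge0// mulr_ge0.
- exact: emeasurable_funD.
rewrite ge0_integralD//; last by move=> x _; rewrite lee_fin mulr_ge0.
apply: (@le_trans _ _ (C%:E * ((e / 2 / C)%:E + ((e / 2 / C)%:E + K%:E * moment 6 (f n))))).
  by rewrite lee_pmul2l// leeD// hK.
rewrite addeA -EFinD muleDr//.
rewrite muleA -!EFinM leeD2r// lee_fin.
by rewrite mulrDr [(C * _)%R]mulrC divfK ?gt_eqF// -splitr.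
Qed.

End convergence_in_mean.

(** * Gradients *)

Section sums.
Context {R : realType}.
Local Notation E := (R * R * R)%type.

Lemma cvge0D (a b : nat -> \bar R) : a @ \oo --> 0%E -> b @ \oo --> 0%E ->
  (fun n => a n + b n)%E @ \oo --> 0%E.
Proof. by move=> a0 b0; rewrite -[X in _ --> X]adde0; exact: cvgeD. Qed.

Lemma Rintegral_sum n (f : 'I_n -> E -> R) :
  (forall i, leb3.-integrable setT (EFin \o f i)) ->
  leb3.-integrable setT (EFin \o (fun x => \sum_(i < n) f i x)) /\
  \int[leb3]_x (\sum_(i < n) f i x) = \sum_(i < n) \int[leb3]_x f i x.
Proof.
elim: n f => [|n ih] f fi.
  rewrite big_ord0 (_ : (fun _ => _) = cst 0); last first.
    by apply/funext => x; rewrite big_ord0.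
  by split; [exact: integrable0|rewrite /Rintegral integral0].
have [si se] := ih (fun i => f (widen_ord (leqnSn n) i)) (fun i => fi _).
have -> : (fun x => \sum_(i < n.+1) f i x) =
    fun x => \sum_(i < n) f (widen_ord (leqnSn n) i) x + f ord_max x.
  by apply/funext => x; rewrite big_ord_recr.
rewrite RintegralD// se big_ord_recr/=; split => //.
exact: (integrableD measurableT si (fi ord_max)).
Qed.

Lemma cvge0_sum n (a : 'I_n -> nat -> \bar R) : (forall i, a i @ \oo --> 0%E) ->
  (fun k => \sum_(i < n) a i k)%E @ \oo --> 0%E.
Proof.
elim: n a => [|n ih] a a0.
  by under eq_fun do rewrite big_ord0; exact: cvg_cst.
under eq_fun do rewrite big_ord_recr/=.
exact: cvge0D (ih _ (fun i => a0 _)) (a0 ord_max).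
Qed.

End sums.

Section gradients.
Context {R : realType}.
Local Notation E := (R * R * R)%type.
Implicit Types (x v : E) (f g u : E -> R) (i j : 'I_3) (G : 'I_3 -> E -> R).

Lemma normr_Rintegral_le f : leb3.-integrable setT (EFin \o f) ->
  ((`|\int[leb3]_x f x|)%:E <= \int[leb3]_x (`|f x|)%:E)%E.
Proof.
move=> fi; rewrite EFin_normr_Rintegral//.
apply: le_abse_integral => //; exact: measurable_int fi.
Qed.

Lemma le_cvg0 (r : R) (c : nat -> \bar R) : (forall n, 0 <= c n)%E ->
  c @ \oo --> 0%E -> (forall n, r%:E <= c n)%E -> r <= 0.
Proof.
move=> c0 /(cvge0P c0) hc rc; apply/ler_addgt0Pr => e e0; rewrite add0r.
have [n _ /(_ n (leqnn n))] := hc e e0.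
by move=> /(le_trans (rc n)); rewrite lee_fin.
Qed.

Lemma smoothM f g : smooth f -> smooth g -> smooth (fun x => f x * g x).
Proof. by move=> sf sg; apply/smooth_genP/gen_mul; exact: gen_smooth. Qed.

Lemma smoothB f g : smooth f -> smooth g -> smooth (fun x => f x - g x).
Proof.
move=> sf sg; apply/smooth_genP/gen_add; first exact: gen_smooth.
by apply: gen_opp; exact: gen_smooth.
Qed.

Lemma test_funM f g : test_fun f -> smooth g -> test_fun (fun x => f x * g x).
Proof.
move=> [sf [r fr]] sg; split; first exact: smoothM.
by exists r => x /fr ->; rewrite mul0r.
Qed.

Lemma test_funB f g : test_fun f -> test_fun g -> test_fun (fun x => f x - g x).
Proof.
move=> [sf [r fr]] [sg [s gs]]; split; first exact: smoothB.
exists (Num.max r s) => x; rewrite gt_max => /andP[/fr -> /gs ->].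
by rewrite subrr.
Qed.

Lemma partialM f g i : smooth f -> smooth g -> partial i (fun x => f x * g x) =
  fun x => f x * partial i g x + g x * partial i f x.
Proof.
move=> sf sg; apply: partial_is_derive => x.
have df := is_derive_partial i x sf; have dg := is_derive_partial i x sg.
exact: is_deriveM.
Qed.

Lemma partialB f g i : smooth f -> smooth g -> partial i (fun x => f x - g x) =
  fun x => partial i f x - partial i g x.
Proof.
move=> sf sg; apply: partial_is_derive => x.
have df := is_derive_partial i x sf; have dg := is_derive_partial i x sg.
exact: is_deriveB.
Qed.

Lemma integral_by_parts f g i : test_fun f -> smooth g ->
  \int[leb3]_x (partial i f x * g x) = - \int[leb3]_x (f x * partial i g x).
Proof.
move=> tf sg; apply/eqP; rewrite -addr_eq0; apply/eqP.
have i1 := test_fun_integrable (test_funM (test_fun_partial i tf) sg).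
have i2 := test_fun_integrable (test_funM tf (smooth_partial i sg)).
rewrite -RintegralD//.
have h : \int[leb3]_x partial i (fun x => f x * g x) x = 0.
  by rewrite /Rintegral (integral_partial_eq0 i (test_funM tf sg)).
rewrite -[RHS]h (partialM _ tf.1 sg); apply: eq_Rintegral => x _.
by rewrite addrC [g x * _]mulrC.
Qed.

Lemma test_fun_moment k f : (0 < k)%N -> test_fun f -> (moment leb3 k f < +oo)%E.
Proof.
move=> k0 tf; have [M fM] := test_fun_bounded tf.
have [r r0 fr] := test_funW tf.
have mf := test_fun_measurable tf.
apply: integrable_moment.
apply: (bounded_support_integrable (measurable_box r) (leb3_box_lty r) _
  (M := M ^+ k)).
- by apply: measurable_funX; exact: measurableT_comp.
- move=> x; rewrite ger0_norm ?exprn_ge0// lerXn2r ?nnegrE//.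
  exact: le_trans (fM x).
- by move=> x /notin_box/fr ->; rewrite normr0 expr0n -(prednK k0).
Qed.

Lemma momentN k f : moment leb3 k (fun x => - f x) = moment leb3 k f.
Proof. by rewrite /moment; under eq_integral do rewrite normrN. Qed.

Lemma momentB_le k f g : measurable_fun setT f -> measurable_fun setT g ->
  (moment leb3 k (fun x => f x - g x)%R
    <= (2 ^+ k)%:E * (moment leb3 k f + moment leb3 k g))%E.
Proof.
move=> mf mg; rewrite -[X in (_ + X)%E]momentN; apply: momentD_le => //.
exact: measurableT_comp.
Qed.

Lemma le_moment k f g (C : R) : measurable_fun setT f -> measurable_fun setT g ->
  0 <= C -> (forall x, `|f x| <= C * `|g x|) ->
  (moment leb3 k f <= (C ^+ k)%:E * moment leb3 k g)%E.
Proof.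
move=> mf mg C0 fg; have mF := measurable_normX k mf.
have mG := measurable_normX k mg.
rewrite -ge0_integralZl_EFin ?exprn_ge0//.
apply: ge0_le_integral => //; first exact: measurable_funeM.
by move=> x _; rewrite -EFinM lee_fin -exprMn lerXn2r ?nnegrE ?mulr_ge0.
Qed.

Lemma cvg_moment_le k (h f g : nat -> E -> R) (C : R) :
  (forall n, moment leb3 k (h n)
     <= C%:E * (moment leb3 k (f n) + moment leb3 k (g n)))%E -> 0 <= C ->
  (fun n => moment leb3 k (f n)) @ \oo --> 0%E ->
  (fun n => moment leb3 k (g n)) @ \oo --> 0%E ->
  (fun n => moment leb3 k (h n)) @ \oo --> 0%E.
Proof.
move=> hfg C0 f0 g0.
have Cs : (fun n => C%:E * (moment leb3 k (f n) + moment leb3 k (g n)))%E @ \oo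
    --> 0%E.
  by rewrite -[X in _ --> X](mule0 C%:E); apply: cvgeZl => //; exact: cvge0D.
apply: squeeze_cvge Cs; last exact: cvg_cst.
by apply: nearW => n; rewrite moment_ge0 /= hfg.
Qed.

Lemma D12_gradP u G : D12_grad u G ->
  [/\ measurable_fun setT u, forall i, measurable_fun setT (G i),
   forall i, (moment leb3 2 (G i) < +oo)%E &
   exists w : nat -> E -> R, [/\ forall n, test_fun (w n),
     (fun n => moment leb3 6 (fun x => w n x - u x)) @ \oo --> 0%E &
     forall i, (fun n => moment leb3 2 (fun x => partial i (w n) x - G i x)) @ \oo
       --> 0%E]].
Proof.
move=> [mu mG [w [tw w6 w2]]].
have {}w6 := (@Lnorm_cvg0 _ _ _ leb3 6 (fun n x => w n x - u x) isT).1 w6.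
have {}w2 i := (@Lnorm_cvg0 _ _ _ leb3 2
  (fun n x => partial i (w n) x - G i x) isT).1 (w2 i).
split => // [i|]; last by exists w; split.
have /(cvge0P (fun n => moment_ge0 _ _ _))/(_ 1 ltr01)[n _ /(_ n (leqnn n))] := w2 i.
move=> wn1; set z := partial i (w n).
have tz : test_fun z by exact: test_fun_partial.
have mz := test_fun_measurable tz.
have -> : G i = (fun x => z x - (z x - G i x)).
  by apply/funext => x; rewrite subKr.
apply: (le_lt_trans (momentB_le 2 mz _)); first exact: measurable_funB.
rewrite lte_mul_pinfty ?lee_fin//.
rewrite lte_add_pinfty//; first exact: test_fun_moment.
by apply: le_lt_trans wn1 _; rewrite ltry.
Qed.

(** The difference D of two gradients of the same function is orthogonal to every
    test function, because integrating by parts moves the derivative off a sequence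
    that tends to 0; and D is itself a limit of test functions. *)
Lemma D12_grad_unique u G G' i : D12_grad u G -> D12_grad u G' ->
  {ae leb3, forall x, G i x = G' i x}.
Proof.
move=> /D12_gradP[mu mG G2 [w [tw w6 w2]]] /D12_gradP[_ mG' G'2 [w' [tw' w'6 w'2]]].
pose D x := G i x - G' i x; pose z n x := w n x - w' n x.
have mw n := test_fun_measurable (tw n); have mw' n := test_fun_measurable (tw' n).
have mD : measurable_fun setT D by exact: measurable_funB.
have D2 : (moment leb3 2 D < +oo)%E.
  apply: le_lt_trans (momentB_le 2 (mG i) (mG' i)) _.
  by rewrite lte_mul_pinfty ?lee_fin// lte_add_pinfty.
have tz n : test_fun (z n) by exact: test_funB.
have mz n := test_fun_measurable (tz n).
have tdz n := test_fun_partial i (tz n).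
have mdz n := test_fun_measurable (tdz n).
have dzE n x : partial i (z n) x = partial i (w n) x - partial i (w' n) x.
  by rewrite /z (partialB _ (tw n).1 (tw' n).1).
have z6 : (fun n => moment leb3 6 (z n)) @ \oo --> 0%E.
  apply: (cvg_moment_le (C := 2 ^+ 6) _ _ w6 w'6) => [n|]; last exact: exprn_ge0.
  have -> : z n = fun x => (w n x - u x) - (w' n x - u x).
    by apply/funext => x; rewrite /z opprB addrA subrK.
  by apply: momentB_le; exact: measurable_funB.
have z2 : (fun n => moment leb3 2 (fun x => partial i (z n) x - D x)) @ \oo --> 0%E.
  apply: (cvg_moment_le (C := 2 ^+ 2) _ _ (w2 i) (w'2 i)) => [n|]; last exact: exprn_ge0.
  have -> : (fun x => partial i (z n) x - D x) =
      fun x => (partial i (w n) x - G i x) - (partial i (w' n) x - G' i x).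
    by apply/funext => x; rewrite dzE /D; ring.
  have mdw := test_fun_measurable (test_fun_partial i (tw n)).
  have mdw' := test_fun_measurable (test_fun_partial i (tw' n)).
  by apply: momentB_le; exact: measurable_funB.
have mdzD n : measurable_fun setT (fun x => partial i (z n) x - D x).
  exact: measurable_funB.
have dzD2 n : (moment leb3 2 (fun x => partial i (z n) x - D x)%R < +oo)%E.
  apply: le_lt_trans (momentB_le 2 (mdz n) mD) _.
  by rewrite lte_mul_pinfty ?lee_fin// lte_add_pinfty// test_fun_moment.
have orth psi : test_fun psi -> \int[leb3]_x (D x * psi x) = 0.
  move=> tp; have mp := test_fun_measurable tp.
  have p2 := test_fun_moment (isT : 0 < 2)%N tp.
  have tdp := test_fun_partial i tp; have mdp := test_fun_measurable tdp.
  have [M dpM] := test_fun_bounded tdp.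
  apply/eqP; rewrite -normr_le0.
  have c1 := cvg_integral_normM mp mdzD p2 z2.
  have c2 := cvg_integral_norm_bounded mdp dpM (test_fun_integrable tdp) mz z6.
  apply: (le_cvg0 _ (cvge0D c1 c2)) => n.
    by apply: adde_ge0; apply: integral_ge0 => x _; rewrite lee_fin.
  have i1 := integrableM2 mp (mdzD n) p2 (dzD2 n).
  have i2 := test_fun_integrable (test_funM tdp (tz n).1).
  have i3 := test_fun_integrable (test_funM (tdz n) tp.1).
  have -> : \int[leb3]_x (D x * psi x) =
      - (\int[leb3]_x (psi x * (partial i (z n) x - D x)))
      - (\int[leb3]_x (partial i psi x * z n x)).
    have -> : \int[leb3]_x (partial i psi x * z n x) =
        - \int[leb3]_x (partial i (z n) x * psi x).
      rewrite (integral_by_parts i (tz n) tp.1) opprK.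
      by apply: eq_Rintegral => x _; rewrite mulrC.
    rewrite opprK addrC.
    rewrite -RintegralB//.
    by apply: eq_Rintegral => x _; ring.
  apply: le_trans (leeD (normr_Rintegral_le i1) (normr_Rintegral_le i2)).
  by rewrite -EFinD lee_fin (le_trans (ler_normB _ _))// normrN.
have DD0 : \int[leb3]_x (D x * D x) = 0.
  apply/eqP; rewrite -normr_le0.
  apply: (le_cvg0 _ (cvg_integral_normM mD mdzD D2 z2)) => n.
    by apply: integral_ge0 => x _; rewrite lee_fin.
  have i1 := integrableM2 mD (mdzD n) D2 (dzD2 n).
  have i2 := integrableM2 mD (mdz n) D2 (test_fun_moment (isT : 0 < 2)%N (tdz n)).
  have -> : \int[leb3]_x (D x * D x) =
      - \int[leb3]_x (D x * (partial i (z n) x - D x)).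
    rewrite -[RHS]add0r -(orth _ (tdz n)) -RintegralB//.
    by apply: eq_Rintegral => x _; ring.
  by rewrite normrN; exact: normr_Rintegral_le.
have iDD := integrableM2 mD mD D2 D2.
have : (\int[leb3]_x `|(D x * D x)%:E| = 0)%E.
  rewrite -[RHS]/(0%:E) -DD0 /Rintegral fineK; last exact: integrable_fin_num.
  apply: eq_integral => x _; rewrite gee0_abs//.
  by rewrite lee_fin -expr2 sqr_ge0.
move=> /(ae_eq_integral_abs leb3 measurableT (measurable_int _ iDD)).
apply: filterS => x /(_ I)[] /eqP; rewrite mulf_eq0 orbb subr_eq0.
by move/eqP.
Qed.

Lemma D12_grad_grad u : D12 u -> D12_grad u (grad u).
Proof. by move=> [G uG]; exact: (xgetPex _ (ex_intro _ G uG)). Qed.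

Lemma grad_ae u G i : D12_grad u G -> {ae leb3, forall x, grad u i x = G i x}.
Proof.
by move=> uG; apply: (D12_grad_unique i _ uG); apply: D12_grad_grad; exists G.
Qed.

End gradients.

(** * Integrability of the barrier *)

Section barrier_integrability.
Context {R : realType}.
Local Notation E := (R * R * R)%type.

Lemma integral_prod_lty d1 d2 (T1 : measurableType d1) (T2 : measurableType d2)
    (m1 : {sigma_finite_measure set T1 -> \bar R})
    (m2 : {sigma_finite_measure set T2 -> \bar R}) (a : T1 -> R) (b : T2 -> R) :
  measurable_fun setT a -> measurable_fun setT b ->
  (forall x, 0 <= a x) -> (forall y, 0 <= b y) ->
  (\int[m1]_x (a x)%:E < +oo)%E -> (\int[m2]_y (b y)%:E < +oo)%E ->
  (\int[m1 \x m2]_z (a z.1 * b z.2)%:E < +oo)%E.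
Proof.
move=> ma mb a0 b0 ia ib.
have mab : measurable_fun setT (fun z : T1 * T2 => (a z.1 * b z.2)%:E).
  apply/measurable_EFinP; apply: measurable_funM.
    exact: measurableT_comp ma measurable_fst.
  exact: measurableT_comp mb measurable_snd.
have ab0 (z : T1 * T2) : (0 <= (a z.1 * b z.2)%:E)%E by rewrite lee_fin mulr_ge0.
rewrite (fubini_tonelli1 _ mab ab0) /fubini_F /=.
have ib0 : (0 <= \int[m2]_y (b y)%:E)%E.
  by apply: integral_ge0 => y _; rewrite lee_fin.
rewrite (eq_integral (fun x => (a x)%:E * \int[m2]_y (b y)%:E)%E); last first.
  move=> x _; under eq_integral do rewrite EFinM.
  rewrite ge0_integralZl_EFin//; last exact/measurable_EFinP.
  by move=> y _; rewrite lee_fin.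
rewrite (@ge0_integralZr _ _ _ m1 setT measurableT (EFin \o a))//; last 2 first.
- exact/measurable_EFinP.
- by move=> x _; rewrite /= lee_fin.
rewrite lte_mul_pinfty//.
- by apply: integral_ge0 => x _; rewrite lee_fin.
- by rewrite ge0_fin_numE//; apply: integral_ge0 => x _; rewrite lee_fin.
Qed.

Lemma oneDsqrV_ge0 (t : R) : 0 <= (oneDsqr t)^-1.
Proof. by rewrite invr_ge0 (le_trans ler01)// oneDsqr_ge1. Qed.

Lemma measurable_oneDsqrV : measurable_fun setT (fun t : R => (oneDsqr t)^-1).
Proof. by apply: continuous_measurable_fun; exact: continuous_oneDsqrV. Qed.

Lemma integral_oneDsqrV_lty : (\int[leb1]_t ((oneDsqr t)^-1)%:E < +oo :> \bar R)%E.
Proof.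
rewrite ge0_integral_leb1; last 2 first.
- by apply/measurable_EFinP; exact: measurable_oneDsqrV.
- by move=> t; rewrite lee_fin oneDsqrV_ge0.
rewrite ge0_symfun_integralT//=.
- rewrite (_ : [set x | _] = `[0, +oo[%classic); last first.
    by apply/seteqP; split => x/=; rewrite in_itv/= andbT.
  by rewrite integral0y_oneDsqr -EFinM ltry.
- exact: continuous_oneDsqrV.
- by move=> t; rewrite /= /oneDsqr sqrrN.
Qed.

Lemma barrier_integrable (c kap : R) : 0 < kap ->
  leb3.-integrable setT (EFin \o barrier c kap).
Proof.
move=> k0; have [D D0 bD] := barrier_decay c k0.
set phi := fun t : R => (oneDsqr t)^-1.
have mphi : measurable_fun setT phi by exact: measurable_oneDsqrV.
have phi0 t : 0 <= phi t by exact: oneDsqrV_ge0.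
have i2 : (\int[leb2]_z (phi z.1 * phi z.2)%:E < +oo)%E.
  exact: (@integral_prod_lty _ _ _ _ leb1 leb1 phi phi mphi mphi phi0 phi0
    integral_oneDsqrV_lty integral_oneDsqrV_lty).
pose phi2 (z : R * R) := phi z.1 * phi z.2.
have mphi2 : measurable_fun setT phi2.
  apply: measurable_funM.
    exact: measurableT_comp mphi measurable_fst.
  exact: measurableT_comp mphi measurable_snd.
have phi20 z : 0 <= phi2 z by rewrite mulr_ge0.
have i3 := @integral_prod_lty _ _ _ _ leb2 leb1 phi2 phi mphi2 mphi phi20 phi0
  i2 integral_oneDsqrV_lty.
have mphi3 : measurable_fun setT (fun x : E => phi2 x.1 * phi x.2).
  apply: measurable_funM.
    exact: measurableT_comp mphi2 measurable_fst.
  exact: measurableT_comp mphi measurable_snd.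
have int3 : leb3.-integrable setT (EFin \o (fun x : E => phi2 x.1 * phi x.2)).
  apply/integrableP; split; first exact/measurable_EFinP.
  under eq_integral do rewrite gee0_abs ?lee_fin ?mulr_ge0//.
  exact: i3.
have mb : measurable_fun setT (barrier c kap).
  by apply: continuous_measurable; apply: smooth_continuous; exact: smooth_barrier.
apply: le_ae_integrable (integrableZl measurableT D int3) => //.
apply: aeW => x /=; rewrite (gtr0_norm (barrier_gt0 _ _ _)).
exact: bD.
Qed.

Lemma barrier_bounded (c kap : R) : 0 < kap ->
  exists M, forall x : E, barrier c kap x <= M.
Proof.
move=> k0; have [D D0 bD] := barrier_decay c k0; exists D => x.
apply: (le_trans (bD x)).
have inv1 (t : R) : 0 <= (1 + t ^+ 2)^-1 <= 1.
  by rewrite -/(oneDsqr t) oneDsqrV_ge0 oneDsqrV_le1.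
rewrite ler_piMr//.
have /andP[a0 a1] := inv1 x.1.1; have /andP[b0 b1] := inv1 x.1.2.
have /andP[c0 c1] := inv1 x.2.
by rewrite !mulr_ile1 ?mulr_ge0.
Qed.

Lemma barrier_moment2_lty (c kap : R) : 0 < kap ->
  (moment leb3 2 (barrier c kap) < +oo)%E.
Proof.
move=> k0; have [M bM] := barrier_bounded c k0.
have b0 x := ltW (barrier_gt0 c kap x).
have mb : measurable_fun setT (barrier c kap).
  by apply: continuous_measurable; apply: smooth_continuous; exact: smooth_barrier.
apply: integrable_moment.
apply: le_ae_integrable (integrableZl measurableT M (barrier_integrable c k0)).
  by apply: measurable_funX; exact: measurableT_comp.
apply: aeW => x; rewrite (ger0_norm (b0 x)) ger0_norm ?sqr_ge0// expr2.
by rewrite ler_wpM2r.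
Qed.

Lemma partial_barrier_moment2_lty (c kap : R) i : 0 < kap ->
  (moment leb3 2 (partial i (barrier c kap)) < +oo)%E.
Proof.
move=> k0; have sb := smooth_barrier c kap.
have mb : measurable_fun setT (barrier c kap).
  by apply: continuous_measurable; exact: smooth_continuous.
have mdb : measurable_fun setT (partial i (barrier c kap)).
  by apply: continuous_measurable; apply: smooth_continuous; exact: smooth_partial.
apply: (le_lt_trans (le_moment 2 (C := 1 + kap) mdb mb _ _)).
- by rewrite addr_ge0// ltW.
- move=> x; rewrite (gtr0_norm (barrier_gt0 _ _ _)).
  exact/partial_barrier_le/ltW.
- by rewrite lte_mul_pinfty ?lee_fin ?exprn_ge0 ?addr_ge0 ?(ltW k0)// barrier_moment2_lty.
Qed.

End barrier_integrability.

(** * The truncated difference *)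

Section truncation.
Context {R : realType}.
Local Notation E := (R * R * R)%type.
Context (c kap : R) (kap_gt0 : 0 < kap).
Let W : E -> R := barrier c kap.
Implicit Types (u w : E -> R) (i : 'I_3) (G : 'I_3 -> E -> R).

Definition excess u (x : E) : R := flat 0 (u x - barrier c kap x).

Definition excess_grad u G i (x : E) : R :=
  flat 2 (u x - barrier c kap x) * (G i x - partial i (barrier c kap) x).

Let mW : measurable_fun setT W.
Proof. by apply: continuous_measurable; apply: smooth_continuous; exact: smooth_barrier. Qed.

Let mdW i : measurable_fun setT (partial i W).
Proof.
apply: continuous_measurable; apply: smooth_continuous; apply: smooth_partial.
exact: smooth_barrier.
Qed.

Lemma measurable_flatB k u : measurable_fun setT u ->
  measurable_fun setT (fun x => flat k (u x - W x)).
Proof.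
move=> mu; apply: (@measurableT_comp _ _ _ _ _ _ (flat k)).
  by apply: continuous_measurable_fun; exact: continuous_flat.
exact: measurable_funB.
Qed.

(** Compact support comes for free: off the support of w the difference is
    - W < 0. *)
Lemma test_fun_excess w : test_fun w -> test_fun (excess w).
Proof.
move=> [sw [r wr]]; split.
  apply/smooth_genP/gen_flat/gen_add; first exact: gen_smooth.
  by apply: gen_opp; exact: gen_barrier.
exists r => x /wr wx; rewrite /excess flat_le0// wx sub0r oppr_le0.
exact/ltW/barrier_gt0.
Qed.

Lemma partial_excess w i : smooth w ->
  partial i (excess w) = excess_grad w (partial^~ w) i.
Proof.
move=> sw; apply: partial_is_derive => x.
have sW := smooth_barrier c kap.
have dB : is_derive x (basis3 i) (fun x => w x - W x) (partial i w x - partial i W x).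
  have dw := is_derive_partial i x sw; have dW := is_derive_partial i x sW.
  exact: is_deriveB.
have := is_derive_comp_dir dB (is_derive_flat 0 (w x - W x)).
by rewrite mul0r subr0.
Qed.

Lemma excess_lipschitz u w x :
  `|excess u x - excess w x| <= 2 * `|u x - w x|.
Proof.
rewrite /excess; have := flat_lipschitz 0 (u x - W x) (w x - W x).
by rewrite mul0r addr0 opprB addrA subrK.
Qed.

(** The difference of the gradients of h (w_n - W) and h (u - W) is
      h' (w_n - W) (grad w_n - grad u)
        + (h' (w_n - W) - h' (u - W)) (grad u - grad W).
    The first coefficient is bounded; the second one is both bounded and at most
    a multiple of |w_n - u|, and multiplies a fixed function of L^2. *)
Lemma excess_approx u G : D12_grad u G -> exists v : nat -> E -> R,
  [/\ forall n, test_fun (v n), forall n x, 0 <= v n x,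
    (fun n => moment leb3 6 (fun x => v n x - excess u x)) @ \oo --> 0%E &
    forall i, (fun n => moment leb3 2
      (fun x => partial i (v n) x - excess_grad u G i x)) @ \oo --> 0%E].
Proof.
move=> uG; have [mu mG G2 [w [tw w6 w2]]] := D12_gradP uG.
have mw n := test_fun_measurable (tw n).
have mdw n i := test_fun_measurable (test_fun_partial i (tw n)).
have mwu n : measurable_fun setT (fun x => w n x - u x) by exact: measurable_funB.
have mex v : measurable_fun setT v -> measurable_fun setT (excess v).
  exact: measurable_flatB.
exists (fun n => excess (w n)); split.
- by move=> n; exact: test_fun_excess.
- by move=> n x; exact: flat_ge0.
-  apply: (cvg_moment_le (C := 2 ^+ 6) _ _ w6 w6) => [n|]; last exact: exprn_ge0.
  apply: (@le_trans _ _ ((2 ^+ 6)%:E * moment leb3 6 (fun x => w n x - u x)%R)%E).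
    apply: le_moment => // [|x]; first exact: measurable_funB (mex _ (mw n)) (mex _ mu).
    exact: excess_lipschitz.
  by rewrite lee_pmul2l ?lte_fin ?exprn_gt0// leeDl// moment_ge0.
move=> i.
pose F x := G i x - partial i W x.
pose b n x := flat 2 (w n x - W x) - flat 2 (u x - W x).
have mF : measurable_fun setT F by exact: measurable_funB.
have mb n : measurable_fun setT (b n).
  by apply: measurable_funB; exact: measurable_flatB.
have F2 : (moment leb3 2 F < +oo)%E.
  apply: le_lt_trans (momentB_le 2 (mG i) (mdW i)) _.
  rewrite lte_mul_pinfty ?lee_fin// lte_add_pinfty//.
  exact: partial_barrier_moment2_lty.
have split_diff n : (fun x => partial i (excess (w n)) x - excess_grad u G i x) =
    fun x => flat 2 (w n x - W x) * (partial i (w n) x - G i x) + F x * b n x.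
  apply/funext => x; rewrite (partial_excess _ (tw n).1) /excess_grad /F /b -/W.
  by ring.
have c1 : (fun n => moment leb3 2 (fun x => flat 2 (w n x - W x) *
    (partial i (w n) x - G i x))) @ \oo --> 0%E.
  apply: (cvg_moment_le (C := 2 ^+ 2) _ _ (w2 i) (w2 i)) => [n|]; last exact: exprn_ge0.
  apply: (@le_trans _ _ ((2 ^+ 2)%:E *
      moment leb3 2 (fun x => partial i (w n) x - G i x)%R)%E).
    apply: le_moment => // [||x].
    - by apply: measurable_funM; [exact: measurable_flatB|exact: measurable_funB].
    - exact: measurable_funB.
    - by rewrite normrM ler_wpM2r// ger0_norm ?flat_ge0// flat_le_fact.
  by rewrite lee_pmul2l ?lte_fin ?exprn_gt0// leeDl// moment_ge0.
have c2 : (fun n => moment leb3 2 (fun x => F x * b n x)) @ \oo --> 0%E.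
  pose L : R := 4`!%:R + 2%:R * 3`!%:R.
  have L0 : 0 <= L by rewrite addr_ge0// mulr_ge0.
  have b2 n x : `|b n x| <= 2.
    rewrite /b ler_norml; have := flat_ge0 2 (w n x - W x).
    have := flat_ge0 2 (u x - W x); have := flat_le_fact 2 (w n x - W x).
    have := flat_le_fact 2 (u x - W x); rewrite (_ : 2`!%:R = 2 :> R)//.
    by move=> *; apply/andP; split; lra.
  have bL n x : `|b n x| <= L * `|w n x - u x|.
    rewrite /b (le_trans (flat_lipschitz _ _ _))//.
    by rewrite opprB addrA subrK.
  have sq n : moment leb3 2 (fun x => F x * b n x) =
      (\int[leb3]_x (`|(`|F x| ^+ 2) * (`|b n x| ^+ 2)|)%:E)%E.
    apply: eq_integral => x _; congr (_%:E).
    by rewrite [RHS]ger0_norm ?mulr_ge0 ?exprn_ge0// normrM exprMn.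
  under eq_fun do rewrite sq.
  apply: (cvg_integral_norm_min (C := 4 + 2 * L) _ _ _ mwu) w6 => //.
  - exact: (moment_integrable (k := 2) mF F2).
  - by move=> n; apply: measurable_funX; exact: measurableT_comp.
  - move=> n x; rewrite ger0_norm ?exprn_ge0//.
    have := b2 n x; have := normr_ge0 (b n x).
    by move: (`|b n x|) => t t0 t2; rewrite expr2; nra.
  - move=> n x; rewrite ger0_norm ?exprn_ge0// expr2.
    apply: (@le_trans _ _ (2 * (L * `|w n x - u x|))); first exact: ler_pM.
    by rewrite mulrA ler_wpM2r// lerDr.
apply: (cvg_moment_le (C := 2 ^+ 2) _ _ c1 c2) => [n|]; last exact: exprn_ge0.
rewrite split_diff; apply: momentD_le; apply: measurable_funM => //.
- exact: measurable_flatB.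
- exact: measurable_funB.
Qed.

Lemma D12_grad_excess u G : D12_grad u G -> D12_grad (excess u) (excess_grad u G).
Proof.
move=> uG; have [mu mG _ _] := D12_gradP uG.
have [v [tv _ v6 v2]] := excess_approx uG; split.
- exact: measurable_flatB.
- by move=> i; apply: measurable_funM; [exact: measurable_flatB|exact: measurable_funB].
- exists v; split => // [|i].
    exact: (@Lnorm_cvg0 _ _ _ leb3 6 (fun n x => v n x - excess u x) isT).2.
  exact: (@Lnorm_cvg0 _ _ _ leb3 2
    (fun n x => partial i (v n) x - excess_grad u G i x) isT).2.
Qed.

(** The pointwise inequality for the barrier can only be multiplied by nonnegative
    functions, so the limit is taken along the sequence h (w_n - W) and not along
    an arbitrary approximation of h (u - W). *)
Lemma barrier_supersolution u G : D12_grad u G ->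
  0 <= \sum_(i < 3) (\int[leb3]_x (partial i W x * excess_grad u G i x))
       + kap ^+ 2 * (\int[leb3]_x (W x * excess u x)).
Proof.
move=> uG; have [v [tv v0 v6 v2]] := excess_approx uG.
have [mv mvG vG2 _] := D12_gradP (D12_grad_excess uG).
have sW : smooth W := smooth_barrier c kap.
have mvn n := test_fun_measurable (tv n).
have tdv n i := test_fun_partial i (tv n).
have mdv n i := test_fun_measurable (tdv n i).
have dv2 n i := test_fun_moment (isT : 0 < 2)%N (tdv n i).
have dW2 i : (moment leb3 2 (partial i W) < +oo)%E.
  exact: partial_barrier_moment2_lty.
have W2 : (moment leb3 2 W < +oo)%E by exact: barrier_moment2_lty.
have mB n : measurable_fun setT (fun x => v n x - excess u x).
  exact: measurable_funB.
have mdB n i : measurable_fun setT (fun x => partial i (v n) x - excess_grad u G i x).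
  exact: measurable_funB.
have dB2 n i : (moment leb3 2
    (fun x => partial i (v n) x - excess_grad u G i x)%R < +oo)%E.
  apply: le_lt_trans (momentB_le 2 (mdv n i) (mvG i)) _.
  by rewrite lte_mul_pinfty ?lee_fin// lte_add_pinfty.
have [M WM] := barrier_bounded c kap_gt0.
have WM' x : `|W x| <= M by rewrite (gtr0_norm (barrier_gt0 _ _ _)).
have iW := barrier_integrable c kap_gt0.
have i1 n i := integrableM2 (mdW i) (mdv n i) (dW2 i) (dv2 n i).
have i2 i := integrableM2 (mdW i) (mvG i) (dW2 i) (vG2 i).
have i3 n i := integrableM2 (mdW i) (mdB n i) (dW2 i) (dB2 n i).
have j1 n : leb3.-integrable setT (EFin \o (fun x => W x * v n x)).
  rewrite (_ : (fun x => W x * v n x) = fun x => v n x * W x); last first.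
    by apply/funext => x; rewrite mulrC.
  exact: test_fun_integrable (test_funM (tv n) sW).
have j2 : leb3.-integrable setT (EFin \o (fun x => W x * excess u x)).
  apply: le_ae_integrable iW; first exact: measurable_funM.
  apply: aeW => x; rewrite normrM (gtr0_norm (barrier_gt0 _ _ _)).
  rewrite ler_piMr ?(ltW (barrier_gt0 _ _ _))// ger0_norm ?flat_ge0//.
  exact: flat_le_fact 0 _.
have j3 n : leb3.-integrable setT (EFin \o (fun x => W x * (v n x - excess u x))).
  rewrite (_ : (fun x => _) = fun x => W x * v n x - W x * excess u x); last first.
    by apply/funext => x; rewrite mulrBr.
  exact: (integrableB measurableT (j1 n) j2).
have k20 : 0 <= kap ^+ 2 by exact: sqr_ge0.
have super n : 0 <= \sum_(i < 3) (\int[leb3]_x (partial i W x * partial i (v n) x))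
    + kap ^+ 2 * (\int[leb3]_x (W x * v n x)).
  have ibp i : \int[leb3]_x (partial i W x * partial i (v n) x) =
      - (\int[leb3]_x (v n x * partial i (partial i W) x)).
    rewrite -(integral_by_parts i (tv n) (smooth_partial i sW)).
    by apply: eq_Rintegral => x _; rewrite mulrC.
  have il i : leb3.-integrable setT
      (EFin \o (fun x => v n x * partial i (partial i W) x)).
    apply: test_fun_integrable (test_funM (tv n) _).
    exact/smooth_partial/smooth_partial.
  have [is3 es3] := Rintegral_sum il.
  rewrite (eq_bigr _ (fun i _ => ibp i)) sumrN -es3 addrC subr_ge0.
  rewrite -RintegralZl//; apply: le_Rintegral => //.
    exact: (integrableZl measurableT (kap ^+ 2) (j1 n)).
  move=> x _; rewrite -mulr_sumr.
  apply: le_trans (ler_wpM2l (v0 n x) (laplacian_barrier_le c x (ltW kap_gt0))) _.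
  by rewrite mulrCA (mulrC (W x)).
rewrite -oppr_le0.
pose a n := (\sum_(i < 3) \int[leb3]_x (`|partial i W x *
    (partial i (v n) x - excess_grad u G i x)|)%:E
  + (kap ^+ 2)%:E * \int[leb3]_x (`|W x * (v n x - excess u x)|)%:E)%E.
have a_cvg : a @ \oo --> 0%E.
  apply: cvge0D; first apply: cvge0_sum => i.
    exact: cvg_integral_normM (mdW i) (mdB^~ i) (dW2 i) (v2 i).
  rewrite -[X in _ --> X](mule0 (kap ^+ 2)%:E); apply: cvgeZl => //.
  exact: cvg_integral_norm_bounded mW WM' iW mB v6.
apply: (le_cvg0 _ a_cvg) => n.
  apply: adde_ge0.
    by apply: sume_ge0 => i _; apply: integral_ge0 => x _; rewrite lee_fin.
  by rewrite mule_ge0 ?lee_fin//; apply: integral_ge0 => x _; rewrite lee_fin.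
have e1 i : \int[leb3]_x (partial i W x * excess_grad u G i x) =
    \int[leb3]_x (partial i W x * partial i (v n) x) -
    \int[leb3]_x (partial i W x * (partial i (v n) x - excess_grad u G i x)).
  by rewrite -RintegralB//; apply: eq_Rintegral => x _; ring.
have e2 : \int[leb3]_x (W x * excess u x) =
    \int[leb3]_x (W x * v n x) - \int[leb3]_x (W x * (v n x - excess u x)).
  by rewrite -RintegralB//; apply: eq_Rintegral => x _; ring.
rewrite (eq_bigr _ (fun i _ => e1 i)) e2 sumrB mulrBr.
apply: (@le_trans _ _ (\sum_(i < 3) (\int[leb3]_x (partial i W x *
    (partial i (v n) x - excess_grad u G i x))) +
  kap ^+ 2 * (\int[leb3]_x (W x * (v n x - excess u x))))%:E).
  by rewrite lee_fin; have := super n; lra.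
rewrite EFinD -sumEFin EFinM; apply: leeD.
  apply: lee_sum => i _; apply: le_trans (normr_Rintegral_le (i3 n i)).
  by rewrite lee_fin ler_norm.
rewrite lee_wpmul2l ?lee_fin//; apply: le_trans (normr_Rintegral_le (j3 n)).
by rewrite lee_fin ler_norm.
Qed.

End truncation.

(** * Comparison *)

Section comparison.
Context {R : realType}.
Local Notation E := (R * R * R)%type.
Implicit Types (u f g : E -> R).

Lemma ae_eq_Rintegral f g : measurable_fun setT f -> measurable_fun setT g ->
  {ae leb3, forall x, f x = g x} -> \int[leb3]_x f x = \int[leb3]_x g x.
Proof.
move=> mf mg fg; rewrite /Rintegral; congr fine.
apply: ae_eq_integral => //; try exact/measurable_EFinP.
by apply: filterS fg => x /= -> _.
Qed.

Lemma ae_ge0_Rintegral_le0 f : leb3.-integrable setT (EFin \o f) ->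
  {ae leb3, forall x, 0 <= f x} -> \int[leb3]_x f x <= 0 ->
  {ae leb3, forall x, f x = 0}.
Proof.
move=> fi f0 If; have mf := measurable_int _ fi.
have e : (\int[leb3]_x `|(f x)%:E| = \int[leb3]_x (f x)%:E)%E.
  apply: ae_eq_integral => //; first exact: measurableT_comp.
  by apply: filterS f0 => x fx0 _; rewrite gee0_abs.
have : (\int[leb3]_x `|(EFin \o f) x| = 0)%E.
  apply/eqP; rewrite eq_le; apply/andP; split; last exact: integral_ge0.
  rewrite e -[leLHS]fineK ?lee_fin//; exact: integrable_fin_num.
move=> /(ae_eq_integral_abs leb3 measurableT mf).
by apply: filterS => x /(_ I)[].
Qed.

Lemma measurable_phi_ u : measurable_fun setT (phi_ u).
Proof.
rewrite /phi_; case: xgetP => [f _ [[G []]]//|_]; exact: measurable_cst.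
Qed.

Lemma measurable_Xpow (a : R) u : measurable_fun setT u ->
  measurable_fun setT (fun x => `|u x| `^ a).
Proof.
move=> mu; apply: (@measurableT_comp _ _ _ _ _ _ (@powR R ^~ a)).
  exact: measurable_powR.
exact: measurableT_comp.
Qed.

(** The equation for u and the supersolution property of the barrier W, both tested
    against v = flat 0 (u - W), add up to an integral of nonnegative terms. *)
Lemma le_barrier (g : E -> R) (p lam mu K L r c : R) u :
  measurable_fun setT g -> (forall x, 0 <= g x) ->
  (forall x, r < enorm x -> 3 / 4 <= g x) ->
  1 < p -> 0 < lam -> 0 < mu -> 3 * K `^ (p - 1) - 3 < mu ->
  weak_sol p lam mu g u -> {ae leb3, forall x, `|u x| <= K} ->
  {ae leb3, forall x, 0 < phi_ u x <= L} ->
  (forall x, enorm x <= r -> K <= barrier c (Num.sqrt mu / 2) x) ->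
  {ae leb3, forall x, u x <= barrier c (Num.sqrt mu / 2) x}.
Proof.
move=> mg g0 gr p1 lam0 mu0 Kmu [[u12 uV] usol] uK phiL WK.
set kap := Num.sqrt mu / 2.
have kap0 : 0 < kap by rewrite divr_gt0// sqrtr_gt0.
have kap2 : kap ^+ 2 = mu / 4.
  rewrite exprMn sqr_sqrtr ?ltW//; congr (_ * _).
  by rewrite exprVn; congr (_^-1); ring.
set W := barrier c kap; have W0 x : 0 < W x := barrier_gt0 c kap x.
have mW : measurable_fun setT W.
  by apply: continuous_measurable; apply: smooth_continuous; exact: smooth_barrier.
have uG := D12_grad_grad u12; set G := grad u in uG.
have [meas_u mG G2 _] := D12_gradP uG.
set v := excess c kap u; set H := excess_grad c kap u G.
have vH : D12_grad v H by exact: D12_grad_excess.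
have [mv mH H2 _] := D12_gradP vH.
have v0 x : 0 <= v x by exact: flat_ge0.
have vu x : v x <= 2 * `|u x|.
  have [uW|Wu] := leP (u x) (W x).
    by rewrite /v /excess flat_le0 ?mulr_ge0// subr_le0.
  have := flat_lipschitz 0 (u x - W x) 0.
  rewrite (flat_le0 _ (lexx 0)) !subr0 mul0r addr0 ger0_norm ?flat_ge0//.
  move=> /le_trans; apply; rewrite (_ : 2`!%:R = 2 :> R)// ler_wpM2l//.
  by rewrite (gtr0_norm (lt_trans (W0 x) Wu)) gtr0_norm ?subr_gt0// gerBl ltW.
have V1 x : 1 <= V mu g x by rewrite lerDl mulr_ge0// ltW.
have V0 x : 0 <= V mu g x by exact: le_trans (V1 x).
have mV : measurable_fun setT (V mu g).
  apply: measurable_funD => //; apply: measurable_funM => //.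
have mVu2 : measurable_fun setT (fun x => V mu g x * u x ^+ 2).
  by apply: measurable_funM => //; exact: measurable_funX.
have iVu2 : leb3.-integrable setT (EFin \o (fun x => V mu g x * u x ^+ 2)).
  apply/integrableP; split; first exact/measurable_EFinP.
  apply: le_lt_trans uV; rewrite le_eqVlt; apply/orP; left; apply/eqP.
  by apply: eq_integral => x _; rewrite gee0_abs// lee_fin mulr_ge0 ?sqr_ge0.
(* every lower order integrand is dominated by a multiple of V u^2 *)
have dom (a : E -> R) (C : R) : measurable_fun setT a ->
    {ae leb3, forall x, `|a x| <= C * V mu g x} ->
    leb3.-integrable setT (EFin \o (fun x => a x * u x * v x)).
  move=> ma aC.
  apply: le_ae_integrable (integrableZl measurableT (C * 2) iVu2).
    by apply: measurable_funM => //; exact: measurable_funM.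
  apply: filterS aC => x aC; rewrite !normrM (ger0_norm (v0 x)).
  rewrite -mulrA (_ : C * 2 * _ = (C * V mu g x) * (u x ^+ 2 * 2)); last by ring.
  apply: ler_pM => //; first by rewrite mulr_ge0.
  by rewrite -real_normK ?num_real// expr2 -mulrA ler_wpM2l// mulrC.
have vDV : DV mu g v.
  split; first by exists H.
  have := integrableZl measurableT 4 iVu2 => /integrableP[_]; apply: le_lt_trans.
  apply: ge0_le_integral => //.
  - by move=> x _; rewrite lee_fin mulr_ge0 ?sqr_ge0.
  - apply/measurable_EFinP; apply: measurable_funM => //; exact: measurable_funX.
  - apply: measurableT_comp => //; apply: measurable_funeM.
    exact/measurable_EFinP.
  - move=> x _; rewrite /= lee_fin; apply: le_trans (ler_norm _).
    rewrite [leRHS]mulrCA ler_wpM2l//.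
    rewrite (_ : 4 * u x ^+ 2 = (2 * `|u x|) ^+ 2); last first.
      by rewrite exprMn real_normK ?num_real//; congr (_ * _); ring.
    by rewrite lerXn2r ?nnegrE ?mulr_ge0.
have iGH : leb3.-integrable setT (EFin \o (fun x => \sum_(i < 3) G i x * H i x)).
  have iGHi i := integrableM2 (mG i) (mH i) (G2 i) (H2 i).
  by have [] := Rintegral_sum iGHi.
have mphi := measurable_phi_ u.
have ph_dom : {ae leb3, forall x, `|phi_ u x| <= L * V mu g x}.
  apply: filterS phiL => x /andP[p0 pL]; rewrite gtr0_norm//.
  by apply: (le_trans pL); rewrite ler_peMr// (le_trans (ltW p0)).
have mup := measurable_Xpow (p - 1) meas_u.
have up_le x : `|u x| <= K -> `|u x| `^ (p - 1) <= K `^ (p - 1).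
  move=> uxK; apply: ge0_ler_powR => //; first by rewrite subr_ge0 ltW.
  by rewrite nnegrE (le_trans _ uxK).
have up_dom : {ae leb3, forall x, `|(`|u x| `^ (p - 1))| <= K `^ (p - 1) * V mu g x}.
  apply: filterS uK => x uxK; rewrite ger0_norm ?powR_ge0//.
  by apply: (le_trans (up_le _ uxK)); rewrite ler_peMr ?powR_ge0.
have iV : leb3.-integrable setT (EFin \o (fun x => V mu g x * u x * v x)).
  by apply: (dom _ 1) => //; apply: aeW => x; rewrite mul1r ger0_norm.
have iphi := dom _ _ mphi ph_dom.
have iup := dom _ _ mup up_dom.
have iW := barrier_supersolution c kap0 uG; rewrite -/W -/v -/H in iW.
have mdW i : measurable_fun setT (partial i W).
  apply: continuous_measurable; apply: smooth_continuous; apply: smooth_partial.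
  exact: smooth_barrier.
have iWH : leb3.-integrable setT (EFin \o (fun x => \sum_(i < 3) partial i W x * H i x)) /\
    \int[leb3]_x (\sum_(i < 3) partial i W x * H i x) =
    \sum_(i < 3) \int[leb3]_x (partial i W x * H i x).
  apply: Rintegral_sum => i; apply: integrableM2 => //.
  exact: partial_barrier_moment2_lty.
have iWv : leb3.-integrable setT (EFin \o (fun x => W x * v x)).
  apply: le_ae_integrable (barrier_integrable c kap0); first exact: measurable_funM.
  apply: aeW => x; rewrite normrM (gtr0_norm (barrier_gt0 _ _ _)).
  rewrite ler_piMr ?(ltW (barrier_gt0 _ _ _))// ger0_norm//.
  exact: flat_le_fact 0 _.
case: iWH => iWH eWH; rewrite -eWH in iW.
have sol := usol v vDV.
rewrite /energy_diff (_ : \int[leb3]_x (grad_dot u v x + V mu g x * u x * v x) =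
    \int[leb3]_x (\sum_(i < 3) G i x * H i x + V mu g x * u x * v x)) in sol; last first.
  apply: ae_eq_Rintegral.
  - apply: measurable_funD; last by apply: measurable_funM => //; exact: measurable_funM.
    have [_ mgv _ _] := D12_gradP (D12_grad_grad vDV.1).
    rewrite /grad_dot; under eq_fun do rewrite !big_ord_recl big_ord0.
    by do !apply: measurable_funD => //; apply: measurable_funM.
  - apply: measurable_funD; last by apply: measurable_funM => //; exact: measurable_funM.
    by have /measurable_EFinP := measurable_int _ iGH.
  - have h0 := grad_ae ord0 vH; have h1 := grad_ae (lift ord0 ord0) vH.
    have h2 := grad_ae (lift ord0 (lift ord0 ord0)) vH.
    apply: filterS3 h0 h1 h2 => x e0 e1 e2; congr (_ + _).
    rewrite /grad_dot !big_ord_recl !big_ord0 e0 e1 e2. by [].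
rewrite RintegralD// in sol.
(* the difference of the two tested relations: its integral is at most 0, and
   hhE shows that it is nonnegative *)
pose hh x := \sum_(i < 3) G i x * H i x + V mu g x * u x * v x
  + lam * (phi_ u x * u x * v x) - `|u x| `^ (p - 1) * u x * v x
  - (\sum_(i < 3) partial i W x * H i x + kap ^+ 2 * (W x * v x)).
have ilphi := integrableZl measurableT lam iphi.
have ikW := integrableZl measurableT (kap ^+ 2) iWv.
have i1 := integrableD measurableT iGH iV.
have i2 := integrableD measurableT i1 ilphi.
have i3 := integrableB measurableT i2 iup.
have i4 := integrableD measurableT iWH ikW.
have ihh : leb3.-integrable setT (EFin \o hh) := integrableB measurableT i3 i4.
have hh_le0 : \int[leb3]_x hh x <= 0.
  rewrite /hh RintegralB// RintegralB// RintegralD// RintegralD//.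
  by rewrite RintegralD// !RintegralZl// sol sub0r oppr_le0.
have hhE x : hh x = \sum_(i < 3) flat 2 (u x - W x) * (G i x - partial i W x) ^+ 2
   + ((V mu g x + lam * phi_ u x - `|u x| `^ (p - 1)) * u x - kap ^+ 2 * W x) * v x.
  have -> : \sum_(i < 3) flat 2 (u x - W x) * (G i x - partial i W x) ^+ 2 =
      \sum_(i < 3) G i x * H i x - \sum_(i < 3) partial i W x * H i x.
    rewrite -sumrB; apply: eq_bigr => i _; rewrite /H /excess_grad -/W.
    by move: (flat _ _) (G i x) (partial i W x) => s t t'; ring.
  rewrite /hh; move: (\sum_(i < 3) _) (\sum_(i < 3) _) (V mu g x) (phi_ u x)
    (`|u x| `^ (p - 1)) (u x) (v x) (W x) => *; ring.
have key : {ae leb3, forall x, 0 <= hh x /\ (hh x = 0 -> u x <= W x)}.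
  apply: filterS2 uK phiL => x uxK /andP[ph0 _].
  have s0 : 0 <= \sum_(i < 3) flat 2 (u x - W x) * (G i x - partial i W x) ^+ 2.
    by rewrite sumr_ge0// => i _; rewrite mulr_ge0 ?flat_ge0 ?sqr_ge0.
  have [uW|Wu] := leP (u x) (W x).
    split => //; rewrite hhE (_ : v x = 0) ?mulr0 ?addr0//.
    by rewrite /v /excess flat_le0// subr_le0.
  have ux0 := lt_trans (W0 x) Wu.
  have rx : r < enorm x.
    rewrite ltNge; apply/negP => /WK KW; move: uxK; rewrite gtr0_norm// leNgt.
    by rewrite (le_lt_trans KW).
  have upx := up_le x uxK; have gx := gr x rx.
  (* K^(p-1) < 1 + mu / 3, and 3 / 4 - 1 / 3 > 1 / 4 *)
  have q_gt : kap ^+ 2 < V mu g x + lam * phi_ u x - `|u x| `^ (p - 1).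
    have lp : 0 < lam * phi_ u x by exact: mulr_gt0.
    have mg34 : mu * (3 / 4) <= mu * g x by rewrite ler_pM2l.
    move: lp mg34 upx Kmu; rewrite kap2 /V.
    move: (lam * _) (mu * g x) (`|u x| `^ _) (K `^ _) => ? ? ? ?; lra.
  have vx0 : 0 < v x by rewrite flat_gt0// subr_gt0.
  have pos : 0 < ((V mu g x + lam * phi_ u x - `|u x| `^ (p - 1)) * u x
      - kap ^+ 2 * W x) * v x.
    rewrite mulr_gt0// subr_gt0 (@lt_trans _ _ (kap ^+ 2 * u x))//.
      by rewrite ltr_pM2l// exprn_gt0.
    by rewrite ltr_pM2r.
  have hx : 0 < hh x by rewrite hhE ltr_wpDl.
  by split; [exact: ltW|move=> h; rewrite h ltxx in hx].
have hh0 : {ae leb3, forall x, hh x = 0}.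
  by apply: ae_ge0_Rintegral_le0 => //; apply: filterS key => x [].
by apply: filterS2 key hh0 => x [_ h] /h.
Qed.

Lemma admissible_ge (g : E -> R) : admissible g ->
  exists r, forall x, r < enorm x -> 3 / 4 <= g x.
Proof.
move=> [_ _ _ _]; rewrite limf_einfE => gsup.
have : ((3 / 4)%:E < ereal_sup
    [set ereal_inf ((EFin \o g) @` A) | A in @at_infty R])%E.
  by rewrite gsup lte_fin; lra.
move=> /ereal_sup_gt[_ [A [r Ar] <-] infA]; exists r => x /Ar Ax.
rewrite -lee_fin (le_trans (ltW infA))//; apply: ereal_inf_lbound.
by exists x.
Qed.

(** Using |K| + 1 instead of K makes the constant A positive whatever K is. *)
Lemma bounded_sol_decay (g : E -> R) (p K : R) : admissible g -> 1 < p ->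
  exists A R0 : R, [/\ 0 < A, 0 < R0 &
    forall (lam mu alpha c L M : R) u, 0 < lam -> 0 < mu ->
      3 * K `^ (p - 1) - 3 < mu -> bounded_sol g p lam mu alpha c K L M u ->
      {ae leb3, forall x, R0 < enorm x ->
        u x <= A * enorm x `^ (- 2^-1)
               * expR (- (Num.sqrt mu / 2 * (enorm x - R0)))}].
Proof.
move=> gadm p1; have [[mg _] g0 _ _ _] := gadm.
have [r gr] := admissible_ge gadm.
have K0 : 0 < `|K| + 1 by rewrite ltr_pwDr.
have r0 : 0 < 1 + r ^+ 2 by rewrite ltr_wpDr ?sqr_ge0.
exists ((`|K| + 1) * (1 + r ^+ 2) `^ 4^-1), (Num.sqrt (1 + r ^+ 2)).
split; first by rewrite mulr_gt0// powR_gt0.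
  by rewrite sqrtr_gt0.
move=> lam mu alpha c L M u lam0 mu0 Kmu [[sol _] _ _ uK phiL].
have k0 : 0 <= Num.sqrt mu / 2 by rewrite divr_ge0// sqrtr_ge0.
have K1 : K <= `|K| + 1 by rewrite (le_trans (ler_norm K))// lerDl.
have := le_barrier mg g0 gr p1 lam0 mu0 Kmu sol uK phiL
  (fun x xr => le_trans K1 (barrier_on_ge K0 k0 xr)).
apply: filterS => x ux Rx; apply: (le_trans ux).
apply: barrier_on_le => //; apply: lt_trans Rx.
by rewrite sqrtr_gt0.
Qed.

End comparison.

Theorem theorem1p5 (R : realType) (p : R) (g : R * R * R -> R)
    (g_adm : admissible g) :
  (1 < p < 2 ->
   forall (lamstar : R) (alpha c : R -> R) (M C : R -> R -> R),
   sub_existence g p lamstar alpha c M C ->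
   forall lam : R, 0 < lam < lamstar ->
   forall u : R -> R * R * R -> R,
   (forall mu, sub_range p lam mu -> sub_sol g p alpha c M C lam mu (u mu)) ->
   exists A R0 : R, [/\ 0 < A, 0 < R0 &
     forall mu, 0 < mu -> 3 * Cpl p lam `^ (p - 1) - 3 < mu ->
     {ae leb3, forall x, R0 < enorm x ->
       u mu x <= A * enorm x `^ (- 2^-1)
                 * expR (- (Num.sqrt mu / 2 * (enorm x - R0)))}])
  /\
  (3 <= p < 5 ->
   forall (alpha : R) (c M0 M1 M : R -> R),
   super_existence g p alpha c M0 M1 M ->
   forall lam : R, 0 < lam ->
   forall u : R -> R * R * R -> R,
   (forall mu, super_range p M0 lam mu ->
     super_sol g p alpha c M0 M1 M lam mu (u mu)) ->
   exists A R0 : R, [/\ 0 < A, 0 < R0 &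
     forall mu, 0 < mu -> 3 * M0 lam `^ (p - 1) - 3 < mu ->
     {ae leb3, forall x, R0 < enorm x ->
       u mu x <= A * enorm x `^ (- 2^-1)
                 * expR (- (Num.sqrt mu / 2 * (enorm x - R0)))}]).
Proof.
have weaken (X mu : R) : 0 < mu -> 3 * X - 3 < mu -> X - 1 < mu.
  by move=> mu0 Xmu; have [X1|X1] := leP X 1; lra.
split=> [/andP[p1 _] lamstar alpha c M C _ lam /andP[lam0 _] u usol|].
  have [A [R0 [A0 R00 decay]]] := bounded_sol_decay (Cpl p lam) g_adm p1.
  exists A, R0; split => // mu mu0 Xmu.
  have in_range : sub_range p lam mu by split => //; exact: weaken.
  exact: decay lam0 mu0 Xmu (usol mu in_range).
move=> /andP[p3 _] alpha c M0 M1 M _ lam lam0 u usol.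
have p1 : 1 < p by lra.
have [A [R0 [A0 R00 decay]]] := bounded_sol_decay (M0 lam) g_adm p1.
exists A, R0; split => // mu mu0 Xmu.
have in_range : super_range p M0 lam mu.
  by rewrite /super_range gt_max mu0; exact: weaken.
exact: decay lam0 mu0 Xmu (usol mu in_range).
Qed.
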